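(* Let $\Delta = \bigoplus_{j=1}^N\left( \bigoplus_{n=1}^{\infty}(\mathbb{Z}/p_j\mathbb{Z}) \right)$ with $N \ge 1$ and $p_1, \dots, p_N$ prime. Suppose $\Gamma = \Delta \oplus F$, where $F$ is a finite abelian group. Then there exists a sequence $(r_n)_{n \in \mathbb{N}}$ in $\Gamma$ such that for every $s \in \Delta$, $(r_n - s)_{n \in \mathbb{N}}$ is a freely rigid-recurrent sequence in $\Gamma$.
   Context: Here $\Delta$ is identified with the subgroup $\Delta\oplus\{0\}$ of $\Gamma$, and $\Gamma$ is given the discrete topology. A measure-preserving system (or system, or measure-preserving action) for $\Gamma$ is a quadruple $(X, \mathcal{B}, \mu, (T_g)_{g \in \Gamma})$, where $(X,\mathcal{B},\mu)$ is a non-atomic Lebesgue probability space and $(T_g)_{g\in\Gamma}$ is an action of $\Gamma$ by measure-preserving transformations. A sequence $(a_n)_{n\in\mathbb{N}}$ in $\Gamma$ is a rigidity sequence for the system if $\|f\circ T_{a_n} - f\|_2 \to 0$ for every $f \in L^2(\mu)$. The system is free if $\mu(\{x\in X : T_gx = x\}) = 0$ for every $g\in\Gamma\setminus\{0\}$. A set $R\subseteq\Gamma$ is a set of recurrence if for every measure-preserving system $(X,\mathcal{B},\mu,(T_g)_{g\in\Gamma})$ and every $A\in\mathcal{B}$ with $\mu(A)>0$ there is an $r\in R\setminus\{0\}$ with $\mu(A\cap T_r^{-1}A)>0$. A sequence $(r_n)_{n\in\mathbb{N}}$ in $\Gamma$ is freely rigid-recurrent if it is a rigidity sequence for a free action of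 $\Gamma$ and $\{r_n : n\in\mathbb{N}\}$ is a set of recurrence. *)

(* Defs.v *)
From HB Require Import structures.
From mathcomp Require Import all_boot all_order all_algebra.
From mathcomp Require Import all_classical all_reals all_analysis.

Set Implicit Arguments.
Unset Strict Implicit.
Unset Printing Implicit Defensive.
Import Order.TTheory GRing.Theory Num.Theory.
Import numFieldNormedType.Exports.
Local Open Scope classical_set_scope.
Local Open Scope ring_scope.

Record dirsum (I : Type) (G : I -> zmodType) := DirSum {
  dirsum_fun :> forall i, G i;
  dirsum_finite : finite_set [set i | dirsum_fun i <> 0] }.

Section DirSumZmodule.
Variables (I : Type) (G : I -> zmodType).
Implicit Types f g h : dirsum G.

HB.instance Definition _ := gen_eqMixin (dirsum G).
HB.instance Definition _ := gen_choiceMixin (dirsum G).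

Lemma dirsumP f g : (forall i, f i = g i) -> f = g.
Proof.
case: f g => [f Hf] [g Hg] /= fg.
have {}fg : f = g by apply: functional_extensionality_dep.
by rewrite fg in Hf *; congr DirSum; exact: Prop_irrelevance.
Qed.

Lemma dirsum0_subproof : finite_set [set i | (0 : G i) <> 0].
Proof. by apply: sub_finite_set (@finite_set0 I) => i /= /(_ erefl). Qed.

Lemma dirsumN_subproof f : finite_set [set i | - f i <> 0].
Proof.
apply: sub_finite_set (dirsum_finite f) => i /= + fi0; apply.
by rewrite fi0 oppr0.
Qed.

Lemma dirsumD_subproof f g : finite_set [set i | f i + g i <> 0].
Proof.
have fU : finite_set ([set i | f i <> 0] `|` [set i | g i <> 0]).
  by rewrite finite_setU; split; exact: dirsum_finite.
apply: sub_finite_set fU => i /= fgi.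
have [fi0|] := pselect (f i = 0); last by left.
by right => gi0; apply: fgi; rewrite fi0 gi0 addr0.
Qed.

Definition dirsum_zero : dirsum G := DirSum dirsum0_subproof.
Definition dirsum_opp f : dirsum G := DirSum (dirsumN_subproof f).
Definition dirsum_add f g : dirsum G := DirSum (dirsumD_subproof f g).

Lemma dirsum_addA : associative dirsum_add.
Proof. by move=> f g h; apply: dirsumP => i /=; rewrite addrA. Qed.

Lemma dirsum_addC : commutative dirsum_add.
Proof. by move=> f g; apply: dirsumP => i /=; rewrite addrC. Qed.

Lemma dirsum_add0 : left_id dirsum_zero dirsum_add.
Proof. by move=> f; apply: dirsumP => i /=; rewrite add0r. Qed.

Lemma dirsum_addN : left_inverse dirsum_zero dirsum_opp dirsum_add.
Proof. by move=> f; apply: dirsumP => i /=; rewrite addNr. Qed.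

HB.instance Definition _ := GRing.isZmodule.Build (dirsum G)
  dirsum_addA dirsum_addC dirsum_add0 dirsum_addN.

End DirSumZmodule.

(* 'Z_m is the ring of integers modulo m only for 1 < m, which holds for the
   prime values of p used here. *)
Definition torsion_sum (N : nat) (p : 'I_N -> nat) : zmodType :=
  dirsum (fun j : 'I_N => dirsum (fun _ : nat => 'Z_(p j) : zmodType)).

(* E is a Lebesgue measurable subset of the line: the library equips the domain
   of completed_lebesgue_measure with the Caratheodory sigma-algebra, which is
   the completion of the Borel sigma-algebra. *)
Definition lebesgue_measurable (R : realType) (E : set R) : Prop :=
  ((wlength (@idfun R))^*)%mu.-cara.-measurable E.

(* Isomorphism mod 0 with [0, 1], equipped with the Lebesgue measurable sets
   and Lebesgue measure: a bimeasurable measure-preserving bijection phi between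
   sets M and M' of full measure. *)
Definition nonatomic_lebesgue (R : realType) (d : measure_display)
    (X : measurableType d) (mu : probability X R) : Prop :=
  exists (M : set X) (M' : set R) (phi : X -> R),
    [/\ measurable M /\ mu M = 1%E,
        [/\ lebesgue_measurable M', M' `<=` `[0, 1]
          & completed_lebesgue_measure M' = 1%E],
        set_bij M M' phi,
        forall A, A `<=` M ->
          (measurable A <-> lebesgue_measurable (phi @` A))
      & forall A, A `<=` M -> measurable A ->
          completed_lebesgue_measure (phi @` A) = mu A].

Section Systems.
Variables (R : realType) (G : zmodType).

Definition system (d : measure_display) (X : measurableType d)
    (mu : probability X R) (T : G -> X -> X) : Prop :=
  [/\ nonatomic_lebesgue mu,
      T 0 = id /\ (forall g h, T (g + h) = T g \o T h),
      forall g, measurable_fun [set: X] (T g)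
    & forall g A, measurable A -> mu (T g @^-1` A) = mu A].

Definition free_system (d : measure_display) (X : measurableType d)
    (mu : probability X R) (T : G -> X -> X) : Prop :=
  system mu T /\ forall g, g != 0 -> mu.-negligible [set x | T g x = x].

(* L^2 is the library's, hence real-valued. For complex-valued f the same
   convergence follows from that of the real and imaginary parts. *)
Definition rigidity_sequence (d : measure_display) (X : measurableType d)
    (mu : probability X R) (T : G -> X -> X) (a : nat -> G) : Prop :=
  forall f : X -> R, f \in Lfun mu 2%:E ->
    'N[mu]_2%:E[EFin \o (f \o T (a n) \- f)%R]%E @[n --> \oo] --> 0%E.

Definition set_of_recurrence (S : set G) : Prop :=
  forall (d : measure_display) (X : measurableType d) (mu : probability X R)
    (T : G -> X -> X), system mu T ->
  forall A : set X, measurable A -> (0 < mu A)%E ->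
  exists r : G, [/\ S r, r != 0 & (0 < mu (A `&` T r @^-1` A))%E].

Definition freely_rigid_recurrent (r : nat -> G) : Prop :=
  (exists (d : measure_display) (X : measurableType d) (mu : probability X R)
     (T : G -> X -> X), free_system mu T /\ rigidity_sequence mu T r) /\
  set_of_recurrence (range r).

End Systems.

(* Main.v *)
Require Import Defs.
From HB Require Import structures.
From mathcomp Require Import all_boot all_order all_algebra.
From mathcomp Require Import all_classical all_reals all_analysis.
From mathcomp Require Import measurable_realfun.
From mathcomp Require Import zify ring lra.

Set Implicit Arguments.
Unset Strict Implicit.
Unset Printing Implicit Defensive.
Import Order.TTheory GRing.Theory Num.Theory.
Import numFieldNormedType.Exports.
Local Open Scope classical_set_scope.
Local Open Scope ring_scope.

(** Let A be the product of the groups Z/p_j, so that Delta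
    is the group of finitely supported functions nat -> A, and let 1 in A have
    all its components equal to 1.  Split nat into consecutive blocks of lengths
    n_m = 4 (m+1)^3, let S_m be the set of the x supported on block m that
    differ from 1 on at most n_m / (m+1) positions of the block, and let t_m
    enumerate Delta, each element infinitely often.  The sequence enumerates the
    union of the sets t_m + S_m.

    Recurrence: {r_n - s} contains S_m for every m with t_m = s.  Concentration
    of measure in the product A^(n_m) (the Hamming distance to a set has
    variance at most n_m) shows that every set B of density at least 1/(m+1)
    contains b, b' with b' - b in S_m; averaging over the orbit of a point
    transfers this to measure-preserving systems.

    Rigidity of r_n - s: choose a random position w_m in each block and let
    Phi_w be the infinite composition of the transvections
    v |-> v + v(w_m) (s - t_m).  If x in S_m equals 1 at w_m, an event of
    probability at least 1 - 1/(m+1), then Phi_w (t_m + x - s) = x, which lives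
    on block m only.  Hence Delta x F acts on triples (z, f, w) with z in A^nat
    and f in F^nat by z |-> z + Phi_w g and a translation of f_0; this action is
    not ergodic, but it is free because Phi_w is injective, and it is rigid
    along r_n - s because any finite set of coordinates of (z, f, w) is
    eventually fixed with probability close to 1.  As g moves finitely many
    coordinates only, in the mixed radix expansion of the points of [0, 1) it is
    a permutation of finitely many intervals by translations. *)

(** * Piecewise translations of the unit interval *)

Section LebesgueTranslation.
Variable R : realType.

Definition lline := caratheodory_type (wlength (@idfun R))^*%mu.

Definition translate (c : R) (A : set R) : set R := [set x + c | x in A].

Local Notation leb := (wlength (@idfun R))^*%mu.

Lemma translate_ocitv (c : R) (I : set (ocitv_type R)) :
  measurable I ->
  measurable (translate c I : set (ocitv_type R)) /\
  wlength idfun (translate c I) = wlength (@idfun R) I.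
Proof.
move=> /ocitvP [->|[[a b]] /= ab ->].
  by rewrite /translate image_set0; split => //; exact: measurable0.
have -> : translate c [set` `]a, b]] = [set` `]a + c, b + c]].
  apply/seteqP; split => [_ [x /= xab <-]|x /=].
    by move: xab; rewrite !in_itv/= lerD2r ltrD2r.
  rewrite in_itv/= => xab; exists (x - c); last by rewrite subrK.
  by rewrite /= in_itv/= ltrBrDr lerBlDr.
split; first exact: is_ocitv.
rewrite !wlength_itv_bnd//=; last by rewrite lerD2r ltW.
  by congr EFin; ring.
exact: ltW.
Qed.

(** A cover of [A] by half-open intervals translates to a cover of the same total length;
    translating back by [- c] gives the converse inequality. *)
Lemma le_translate_leb (c : R) (A : set R) :
  (leb (translate c A) <= leb A)%E.
Proof.
apply: le_ereal_inf_tmp => _ [F [mF AF] <-].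
apply: ereal_inf_lbound; exists (fun k => translate c (F k)).
  split=> [k|]; first exact: (translate_ocitv c (mF k)).1.
  by move=> _ [x /AF[k _ Fkx] <-]; exists k => //; exists x.
by apply: eq_eseriesr => k _; exact: (translate_ocitv c (mF k)).2.
Qed.

Lemma translateK (c : R) (A : set R) :
  translate (- c) (translate c A) = A.
Proof.
apply/seteqP; split => [_ [_ [x Ax <-] <-]|x Ax]; first by rewrite addrK.
by exists (x + c); [exists x|rewrite addrK].
Qed.

Lemma translate_leb (c : R) (A : set R) :
  leb (translate c A) = leb A.
Proof.
apply/eqP; rewrite eq_le le_translate_leb/=.
by rewrite -[X in (leb X <= _)%E](translateK c) le_translate_leb.
Qed.

Lemma translateE (c : R) (A : set R) : translate c A = [set x | A (x - c)].
Proof.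
apply/seteqP; split => [_ [x Ax <-]|x /= Ax]; first by rewrite /= addrK.
by exists (x - c); rewrite ?subrK.
Qed.

Lemma translate_measurable (c : R) (A : set lline) :
  measurable A -> measurable (translate c A : set lline).
Proof.
move=> mA; change (leb.-caratheodory (translate c A)) => Y.
have {}mA : leb.-caratheodory A := mA.
rewrite -(translate_leb (- c) Y) mA -(translate_leb c (_ `&` A)).
rewrite -(translate_leb c (_ `&` ~` A)) !translateE.
congr (leb _ + leb _)%E; apply/seteqP; split=> x /=; by rewrite opprK subrK.
Qed.

Lemma itv_lmeasurable (i : interval R) : measurable ([set` i] : set lline).
Proof.
apply: sub_caratheodory.
exact: (measurable_itv i : measurable ([set` i] : set (measurableTypeR R))).
Qed.

Lemma completed_lebesgue_itv (a b : R) : a <= b ->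
  completed_lebesgue_measure [set` `[a, b[] = (b - a)%:E.
Proof.
move=> ab; transitivity (lebesgue_measure [set` `[a, b[]); first by [].
rewrite lebesgue_measure_itv/= lte_fin EFinB.
by case: ltP => // ba; rewrite (le_anti (introT andP (conj ab ba))) subee.
Qed.

(** For a < B this is the interval [a/B, (a+1)/B), in a form where each point computes the index of
    its own cell. *)
Definition cell (B a : nat) : set R :=
  [set x | 0 <= x < 1 /\ Num.truncn (B%:R * x) = a].

Lemma cellE (B a : nat) : (a < B)%N ->
  cell B a = [set` `[a%:R / B%:R, a.+1%:R / B%:R[].
Proof.
move=> aB; have B0 : 0 < B%:R :> R by rewrite ltr0n (leq_ltn_trans _ aB).
apply/seteqP; split => x /=;
  rewrite in_itv/= ler_pdivrMr// ltr_pdivlMr// (mulrC x).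
  move=> [/andP[x0 x1] /eqP]; rewrite truncn_eq//.
  by rewrite mulr_ge0// ltW.
move=> xa; have x0 : 0 <= x.
  rewrite -(pmulr_rge0 _ B0); move/andP: xa => [+ _]; exact: le_trans.
split; last by apply/eqP; rewrite truncn_eq// mulr_ge0// ltW.
rewrite x0 -(ltr_pM2l B0) mulr1; move/andP: xa => [_ /lt_le_trans]; apply.
by rewrite ler_nat.
Qed.

Lemma cell_measurable B a : (a < B)%N -> measurable (cell B a : set lline).
Proof. by move=> aB; rewrite cellE//; exact: itv_lmeasurable. Qed.

Lemma completed_lebesgue_cell B a : (a < B)%N ->
  completed_lebesgue_measure (cell B a) = (B%:R^-1)%:E.
Proof.
move=> aB; have B0 : 0 < B%:R :> R by rewrite ltr0n (leq_ltn_trans _ aB).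
rewrite cellE// completed_lebesgue_itv.
  by rewrite -mulrBl -natrB// subSnn mul1r.
by rewrite ler_pM2r ?invr_gt0// ler_nat.
Qed.

Lemma truncn_lt_base (B : nat) (x : R) : (0 < B)%N -> 0 <= x < 1 ->
  (Num.truncn (B%:R * x) < B)%N.
Proof.
move=> B0 /andP[x0 x1]; rewrite truncn_lt_nat ?mulr_ge0//.
by rewrite gtr_pMr// ltr0n.
Qed.

Lemma bigcup_cell (B : nat) : (0 < B)%N ->
  \bigcup_(a in `I_B) cell B a = [set` `[0, 1[].
Proof.
move=> B0; apply/seteqP; split => [x [a _ []]|x /=]; first by rewrite /= in_itv.
rewrite in_itv/= => x01; exists (Num.truncn (B%:R * x)) => //=.
exact: truncn_lt_base.
Qed.

Lemma trivIset_cell (B : nat) (D : set nat) (F : set R) :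
  trivIset D (fun a => F `&` cell B a).
Proof. by move=> a b _ _ [x [[_ [_ <-]] [_ [_ <-]]]]. Qed.

Section Piecewise.
Variables (S : R -> R) (B : nat) (c : nat -> R).
Hypotheses (B0 : (0 < B)%N)
  (SE : forall x, 0 <= x < 1 -> S x = x + c (Num.truncn (B%:R * x)))
  (Sinj : set_inj [set` `[0, 1[] S).

Lemma piecewise_image (A : set R) : A `<=` [set` `[0, 1[] ->
  S @` A = \bigcup_(a in `I_B) translate (c a) (A `&` cell B a).
Proof.
move=> A01; apply/seteqP; split => [_ [x Ax <-]|_ [a _ [x [Ax [x01 <-]] <-]]].
  have x01 : 0 <= x < 1 by have := A01 _ Ax; rewrite /= in_itv.
  exists (Num.truncn (B%:R * x)); first exact: truncn_lt_base.
  by exists x => //; rewrite SE.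
by exists x => //; rewrite SE.
Qed.

(** [S] translates each cell, and by injectivity the translated pieces stay disjoint, so their
    measures add up to that of [A]. *)
Lemma piecewise_image_measure (A : set lline) : measurable A ->
  A `<=` [set` `[0, 1[] ->
  measurable (S @` A : set lline) /\
  completed_lebesgue_measure (S @` A) = completed_lebesgue_measure A.
Proof.
move=> mA A01.
have mAc a : (a < B)%N -> measurable (A `&` cell B a : set lline).
  by move=> aB; apply: measurableI => //; exact: cell_measurable.
have mtAc a : (a < B)%N ->
    measurable (translate (c a) (A `&` cell B a) : set lline).
  by move=> aB; apply: translate_measurable; exact: mAc.
rewrite piecewise_image//; split; first exact: fin_bigcup_measurable.
have AE : A = \bigcup_(a in `I_B) (A `&` cell B a).
  by rewrite -setI_bigcupr bigcup_cell// setIidl.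
rewrite [in RHS]AE !measure_fin_bigcup//.
- by apply: eq_fsbigr => a _; exact: translate_leb.
- exact: trivIset_cell.
- move=> a b _ _ [_ [[x [Ax [x01 xa]] <-] [y [Ay [y01 yb]]]]].
  rewrite -xa -yb -!SE// => /Sinj yx; rewrite yx ?inE//=; by rewrite in_itv.
Qed.

End Piecewise.

End LebesgueTranslation.

(** * The probability space [0, 1) and its piecewise translations *)

Section Unit.
Variable R : realType.

(** The carrier is the whole line, so that transformations are plain maps from R to R; the
    complement of [0, 1) is a null set. *)
Definition leb01 : set (lline R) -> \bar R :=
  mrestr (@completed_lebesgue_measure R) (@itv_lmeasurable R `[0, 1[).

HB.instance Definition _ := Measure.on leb01.

Let leb01_setT : leb01 setT = 1%E.
Proof. by rewrite /leb01 /mrestr setTI completed_lebesgue_itv// subr0. Qed.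

HB.instance Definition _ :=
  Measure_isProbability.Build _ _ _ leb01 leb01_setT.

Lemma leb01_cell B a : (a < B)%N -> leb01 (cell B a) = (B%:R^-1)%:E.
Proof.
move=> aB; rewrite -(completed_lebesgue_cell R aB) /leb01 /mrestr setIidl//.
by move=> x [x01 _]; rewrite /= in_itv.
Qed.

Lemma nonatomic_leb01 : nonatomic_lebesgue leb01.
Proof.
exists [set` `[0, 1[], [set` `[0, 1[], id; split.
- split; first exact: itv_lmeasurable.
  by rewrite /= /leb01 /mrestr setIid completed_lebesgue_itv// subr0.
- split; first exact: itv_lmeasurable.
    by move=> x /=; rewrite !in_itv/= => /andP[-> /ltW].
  by rewrite completed_lebesgue_itv// subr0.
- by rewrite -{2}(image_id [set` `[0, 1[]); exact: inj_bij.
- by move=> A _; rewrite image_id.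
- move=> A A01 _; rewrite image_id.
  transitivity (completed_lebesgue_measure (A `&` [set` `[0, 1[])); last by [].
  by rewrite setIidl.
Qed.

(** On [0, 1) the preimage by [T] is the image by its inverse [S], which translates each cell; off
    [0, 1) the map [T] is the identity. *)
Lemma piecewise_preimage (T S : R -> R) (B : nat) : (0 < B)%N ->
  (forall x, 0 <= x < 1 -> 0 <= S x < 1 /\ T (S x) = x) ->
  (forall x, 0 <= x < 1 -> 0 <= T x < 1 /\ S (T x) = x) ->
  (forall x, ~~ (0 <= x < 1) -> T x = x) ->
  (forall x y, 0 <= x < 1 -> 0 <= y < 1 ->
     Num.truncn (B%:R * x) = Num.truncn (B%:R * y) -> S x - x = S y - y) ->
  forall A : set (lline R), measurable A ->
  measurable (T @^-1` A : set (lline R)) /\ leb01 (T @^-1` A) = leb01 A.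
Proof.
move=> B0 hS hT Tid Spw A mA.
have m01 := @itv_lmeasurable R `[0, 1[.
have BR0 : B%:R != 0 :> R by rewrite pnatr_eq0 -lt0n.
(* The displacement of a cell is read off at its left endpoint. *)
pose c a := S (a%:R / B%:R) - a%:R / B%:R.
have SE x : 0 <= x < 1 -> S x = x + c (Num.truncn (B%:R * x)).
  move=> x01; rewrite /c -(Spw x) ?subrKC//; last first.
    by rewrite [X in _ = Num.truncn X]mulrC divfK// natrK.
  rewrite divr_ge0//= ltr_pdivrMr ?ltr0n// mul1r ltr_nat.
  exact: truncn_lt_base.
have Sinj : set_inj [set` `[0, 1[] S.
  move=> x y; rewrite !inE/= !in_itv/= => x01 y01 Sxy.
  by rewrite -(hS x x01).2 Sxy (hS y y01).2.
have AI01 : A `&` [set` `[0, 1[] `<=` [set` `[0, 1[] by exact: subIsetr.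
have [mSA SAE] := piecewise_image_measure B0 SE Sinj (measurableI _ _ mA m01)
  AI01.
have TI : T @^-1` A `&` [set` `[0, 1[] = S @` (A `&` [set` `[0, 1[]).
  apply/seteqP; split => [x [/= Ax]|_ [x [Ax +] <-]];
    rewrite /= !in_itv/= => x01.
    have [T01 ST] := hT x x01.
    by exists (T x) => //; split => //=; rewrite in_itv.
  by have [-> ->] := hS x x01.
split; last by rewrite /leb01 /mrestr TI.
have -> : T @^-1` A = S @` (A `&` [set` `[0, 1[]) `|` (A `\` [set` `[0, 1[]).
  rewrite -TI; apply/seteqP; split=> x; last first.
    by move=> [[]//|[Ax /= /negP]]; rewrite in_itv/= => /Tid ->.
  move=> Ax; have [x01|x01] := boolP (0 <= x < 1); first by left.
  right; split; last by rewrite /= in_itv/=; exact/negP.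
  by rewrite -(Tid x).
by apply: measurableU => //; exact: measurableD.
Qed.

End Unit.

(** * Actions on mixed radix digits *)

Section Digits.
Variables (R : realType) (D : nat -> finType) (d0 : forall n, D n).

Let card_gt0 n : (0 < #|D n|)%N.
Proof. by apply/card_gt0P; exists (d0 n). Qed.

Definition radix M := (\prod_(l < M) #|D l|)%N.

Lemma radix_gt0 M : (0 < radix M)%N.
Proof. by rewrite prodn_gt0. Qed.

Lemma radixS M : radix M.+1 = (radix M * #|D M|)%N.
Proof. by rewrite /radix big_ord_recr. Qed.

Definition enc n (x : D n) : nat := index x (enum (D n)).
Definition dec n (a : nat) : D n := nth (d0 n) (enum (D n)) (a %% #|D n|).

Lemma enc_lt n (x : D n) : (enc x < #|D n|)%N.
Proof. by rewrite cardE index_mem mem_enum. Qed.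

Lemma encK n : cancel (@enc n) (dec n).
Proof.
by move=> x; rewrite /dec modn_small ?enc_lt// nth_index// mem_enum.
Qed.

Lemma decK n a : enc (dec n a) = (a %% #|D n|)%N.
Proof. by rewrite /enc /dec index_uniq ?enum_uniq// -cardE ltn_mod. Qed.

(* [code M d] is the numerator of the truncated expansion
   0.d_0 d_1 ... d_(M-1) over the denominator [radix M]. *)
Fixpoint code M (d : forall n, D n) : nat :=
  if M is M'.+1 then (code M' d * #|D M'| + enc (d M'))%N else 0%N.

Lemma code_lt M d : (code M d < radix M)%N.
Proof.
elim: M => [|M IH] /=; first by rewrite radix_gt0.
have e := enc_lt (d M).
rewrite radixS (@leq_trans ((code M d).+1 * #|D M|)) ?leq_mul2r ?IH ?orbT//.
by rewrite mulSn addnC ltn_add2r.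
Qed.

Lemma eq_code M d d' : (forall l, (l < M)%N -> d l = d' l) -> code M d = code M
  d'.
Proof.
elim: M => //= M IH dd'; rewrite IH ?dd'// => l lM; apply: dd'; exact: ltnW.
Qed.

Lemma code_inj M d d' : code M d = code M d' -> forall l, (l < M)%N -> d l = d'
  l.
Proof.
elim: M => //= M IH E l; rewrite ltnS leq_eqVlt => /predU1P[->|lM].
  apply: (can_inj (@encK M)); move: (congr1 (modn^~ #|D M|) E).
  by rewrite /= !modnMDl !modn_small ?enc_lt.
apply: IH lM; move: (congr1 (divn^~ #|D M|) E).
by rewrite /= !divnMDl// !divn_small ?enc_lt// !addn0.
Qed.

(** The digit of index n is the residue modulo [#|D n|] of the numerator truncated just after it;
    [dec] takes this residue itself. *)
Definition dig (x : R) n : D n := dec n (Num.truncn ((radix n.+1)%:R * x)).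

Lemma truncn_divn (x : R) b : 0 <= x -> (0 < b)%N ->
  (Num.truncn (b%:R * x) %/ b)%N = Num.truncn x.
Proof.
move=> x0 b0; apply/esym/eqP; rewrite truncn_eq//.
have bx0 : 0 <= b%:R * x by rewrite mulr_ge0.
have br0 : 0 < b%:R :> R by rewrite ltr0n.
have /andP[t1 t2] := truncn_itv bx0.
set t := Num.truncn _ in t1 t2 *; apply/andP; split.
  rewrite -(ler_pM2l br0); apply: le_trans t1.
  by rewrite -natrM ler_nat mulnC leq_divM.
rewrite -(ltr_pM2l br0); apply: (lt_le_trans t2).
by rewrite -natrM ler_nat mulnC ltn_ceil.
Qed.

Lemma truncn_radix (x : R) M : 0 <= x < 1 ->
  Num.truncn ((radix M)%:R * x) = code M (dig x).
Proof.
move=> /andP[x0 x1]; elim: M => [|M IH] /=.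
  by rewrite /radix big_ord0 mul1r; apply/eqP; rewrite truncn_eq// x0.
have rx0 : 0 <= (radix M)%:R * x by rewrite mulr_ge0.
rewrite /dig decK -IH -(truncn_divn rx0 (card_gt0 M)).
have -> : #|D M|%:R * ((radix M)%:R * x) = (radix M.+1)%:R * x.
  by rewrite radixS natrM; ring.
by rewrite -divn_eq.
Qed.

Lemma eq_dig (x : R) M0 d : 0 <= x < 1 ->
  (forall M, (M0 <= M)%N -> Num.truncn ((radix M)%:R * x) = code M d) ->
  dig x = d.
Proof.
move=> x01 xd; apply: functional_extensionality_dep => n.
have : code (maxn M0 n.+1) (dig x) = code (maxn M0 n.+1) d.
  by rewrite -truncn_radix// xd// leq_maxl.
by move/code_inj; apply; rewrite leq_maxr.
Qed.

(* Replaces the first M digits of x by those of d. *)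
Definition setdig (x : R) (d : forall n, D n) M : R :=
  x + ((code M d)%:R - (code M (dig x))%:R) / (radix M)%:R.

Lemma setdig_level x d M M' : (forall n, (M <= n)%N -> d n = dig x n) ->
  (M <= M')%N -> setdig x d M' = setdig x d M.
Proof.
move=> dx /subnK <-; elim: (M' - M)%N => //= k IH.
rewrite -IH addSn /setdig; congr (_ + _); rewrite /= dx ?leq_addl//.
rewrite !natrD opprD addrACA subrr addr0 radixS !natrM -mulrBl invfM.
by rewrite mulrACA divff ?mulr1// pnatr_eq0 -lt0n.
Qed.

(** The displacement is a multiple of 1 / [radix M], so the point lands in the cell of [d] at the
    same relative position. By [setdig_level] this holds at every level from M on, which determines
    all digits. *)
Lemma setdigP x d M : 0 <= x < 1 -> (forall n, (M <= n)%N -> d n = dig x n) ->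
  0 <= setdig x d M < 1 /\ dig (setdig x d M) = d.
Proof.
move=> x01 dx.
have r0 M' : 0 < (radix M')%:R :> R by rewrite ltr0n radix_gt0.
have key M' : (M <= M')%N ->
    (code M' d)%:R <= (radix M')%:R * setdig x d M < (code M' d).+1%:R.
  move=> MM'; rewrite -(setdig_level dx MM') /setdig mulrDr.
  rewrite mulrCA divff ?mulr1 ?gt_eqF//.
  have : 0 <= (radix M')%:R * x by case/andP: x01 => *; rewrite mulr_ge0.
  move/truncn_itv; rewrite truncn_radix// !mulrS.
  by case/andP=> *; apply/andP; split; lra.
have s01 : 0 <= setdig x d M < 1.
  have /andP[k1 k2] := key M (leqnn M); apply/andP; split.
    by rewrite -(pmulr_rge0 _ (r0 M)); apply: le_trans k1.
  rewrite -(ltr_pM2l (r0 M)) mulr1; apply: (lt_le_trans k2).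
  by rewrite ler_nat code_lt.
split=> //; apply: (@eq_dig _ M) => // M' MM'; apply/eqP.
rewrite truncn_eq ?key//; case/andP: s01 => s0 _.
by rewrite mulr_ge0.
Qed.

(** The numerators below [radix n.+1] run through [radix n] full periods of the residue modulo
    [#|D n|]. *)
Lemma card_dec n (Q : {set D n}) :
  (\sum_(a < radix n.+1) (dec n a \in Q) = radix n * #|Q|)%N.
Proof.
rewrite radixS; elim: (radix n) => [|r IH]; first by rewrite !mul0n big_ord0.
rewrite mulSn addnC -(big_mkord xpredT (fun a => (dec n a \in Q) : nat)).
rewrite (@big_cat_nat _ _ _ (r * #|D n|) 0)/= ?leq_addr// big_mkord IH mulSnr.
congr addn; rewrite -{1}(add0n (r * _)%N) big_addn addKn big_mkord.
rewrite -[RHS]sum1_card [RHS]big_mkcond/=.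
rewrite (reindex (fun i : 'I_#|D n| => dec n i)) /=; last first.
  exists (fun x => Ordinal (enc_lt x)) => [i _|x _ /=]; last exact: encK.
  by apply: val_inj; rewrite /= decK modn_small.
apply: eq_bigr => i _.
have -> : dec n (i + r * #|D n|) = dec n i by rewrite /dec addnC modnMDl.
by case: (_ \in _).
Qed.

(** Each digit is uniformly distributed: the set is a disjoint union of cells, counted by
    [card_dec]. *)
Lemma leb01_dig n (Q : {set D n}) :
  measurable ([set x | 0 <= x < 1 /\ dig x n \in Q] : set (lline R)) /\
  leb01 [set x | 0 <= x < 1 /\ dig x n \in Q] = ((#|Q|)%:R / (#|D n|)%:R)%:E.
Proof.
pose C a : set (lline R) :=
  if dec n a \in Q then cell (radix n.+1) a else set0.
have -> : [set x : R | 0 <= x < 1 /\ dig x n \in Q] =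
    \bigcup_(a in `I_(radix n.+1)) C a.
  apply/seteqP; split => [x [x01 xQ]|x [a /= an]]; rewrite /C.
    exists (Num.truncn ((radix n.+1)%:R * x)); last by rewrite xQ.
    by rewrite /= truncn_lt_base// radix_gt0.
  case: ifPn => // aQ [x01 xa]; split => //.
  by rewrite /dig xa.
have mC a : `I_(radix n.+1) a -> measurable (C a).
  by move=> an; rewrite /C; case: ifP => // _; exact: cell_measurable.
have tC : trivIset `I_(radix n.+1) C.
  move=> a b _ _ [x []]; rewrite /C; case: ifP => // _ [_ <-].
  by case: ifP => // _ [_ <-].
split; first exact: fin_bigcup_measurable.
rewrite measure_fin_bigcup//= -fsbig_ord.
have r0 m : (radix m)%:R != 0 :> R by rewrite pnatr_eq0 -lt0n radix_gt0.
transitivity (\sum_(a < radix n.+1)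
    ((dec n a \in Q)%:R / (radix n.+1)%:R : R)%:E)%E.
  apply: eq_bigr => a _; rewrite /C; case: ifP => _;
    last by rewrite mul0r measure0.
  by rewrite mul1r leb01_cell.
rewrite sumEFin -mulr_suml -natr_sum card_dec radixS !natrM -mulf_div divff//.
by rewrite mul1r.
Qed.

(** * Transfer of an action on digits to the interval *)

Section Action.
Variables (G : zmodType) (act : G -> (forall n, D n) -> (forall n, D n)).
Variable lev : G -> nat.
(* [act g] rewrites the first [lev g] digits as a function of these digits. *)
Hypotheses (act0 : act 0 = id)
  (actD : forall g h, act (g + h) = act g \o act h)
  (act_lev : forall g x n, (lev g <= n)%N -> act g x n = x n)
  (act_loc : forall g x y, (forall l, (l < lev g)%N -> x l = y l) ->
     forall l, (l < lev g)%N -> act g x l = act g y l).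

Definition digact (g : G) (x : R) : R :=
  if 0 <= x < 1 then setdig x (act g (dig x)) (lev g) else x.

Lemma digactP g x : 0 <= x < 1 ->
  0 <= digact g x < 1 /\ dig (digact g x) = act g (dig x).
Proof.
by move=> x01; rewrite /digact x01; apply: setdigP => // n gn; exact: act_lev.
Qed.

Lemma digactE g x M : 0 <= x < 1 -> (lev g <= M)%N ->
  digact g x = setdig x (act g (dig x)) M.
Proof.
move=> x01 gM; rewrite /digact x01 [RHS](@setdig_level _ _ (lev g))// => n gn.
exact: act_lev.
Qed.

Lemma digact0 : digact 0 = id.
Proof.
apply/funext => x; rewrite /digact act0; case: ifP => // _.
by rewrite /setdig subrr mul0r addr0.
Qed.

Lemma digactD g h : digact (g + h) = digact g \o digact h.
Proof.
apply/funext => x /=; have [x01|x01] := boolP (0 <= x < 1); last first.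
  by rewrite /digact !(negbTE x01).
have [h01 hd] := digactP h x01.
(* At a level common to [g], [h] and [g + h] the displacements have the same denominator and
   telescope. *)
pose M := maxn (lev (g + h)) (maxn (lev g) (lev h)).
rewrite (@digactE (g + h) x M) ?leq_maxl//.
rewrite (@digactE g _ M)//; last by rewrite /M maxnCA leq_maxl.
rewrite /setdig hd (@digactE h x M)//; last by rewrite /M !maxnA leq_maxr.
by rewrite /setdig actD/= -[RHS]addrA -mulrDl [X in _ = _ + X / _]addrC subrKA.
Qed.

(** On the cells of level [lev (- g)] the inverse [digact (- g)] is a translation, since by
    [act_loc] the first digits of the image depend only on those of the point. *)
Lemma digact_preserving g (A : set (lline R)) : measurable A ->
  measurable (digact g @^-1` A : set (lline R)) /\
  leb01 (digact g @^-1` A) = leb01 A.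
Proof.
apply: (@piecewise_preimage _ (digact g) (digact (- g)) (radix (lev (- g)))).
- exact: radix_gt0.
- move=> x x01; split; first exact: (digactP (- g) x01).1.
  by have := congr1 (fun f => f x) (digactD g (- g)); rewrite subrr digact0.
- move=> x x01; split; first exact: (digactP g x01).1.
  by have := congr1 (fun f => f x) (digactD (- g) g); rewrite addNr digact0.
- by move=> x /negbTE x01; rewrite /digact x01.
- move=> x y x01 y01; rewrite !truncn_radix// => xy.
  rewrite /digact x01 y01 /setdig xy ![_ + _ - _]addrAC !subrr !add0r.
  congr ((_%:R - _) / _); apply: eq_code; apply: act_loc; exact: code_inj.
Qed.

Lemma digact_system : system (@leb01 R : probability (lline R) R) digact.
Proof.
split; first exact: nonatomic_leb01.
- by split; [exact: digact0|exact: digactD].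
- by move=> g _ A mA; rewrite setTI; exact: (digact_preserving g mA).1.
- by move=> g A mA; exact: (digact_preserving g mA).2.
Qed.

Lemma digact_free : (forall g, g != 0 -> forall x, act g x <> x) ->
  free_system (@leb01 R : probability (lline R) R) digact.
Proof.
move=> act_free; split; first exact: digact_system.
move=> g g0; exists (~` [set` `[0, 1[]); split.
- by apply: measurableC; exact: itv_lmeasurable.
- rewrite /= /leb01 /mrestr setICl; exact: measure0.
- move=> x /= gx; rewrite in_itv/= => x01; apply: (act_free g g0 (dig x)).
  by rewrite -(digactP g x01).2 gx.
Qed.

(** The point and its image lie in the same cell of length 1 / [radix L]. *)
Lemma digact_close g x L : 0 <= x < 1 ->
  (forall l, (l < L)%N -> act g (dig x) l = dig x l) ->
  `|digact g x - x| <= (radix L)%:R^-1.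
Proof.
move=> x01 gx; have [g01 gd] := digactP g x01.
have r0 : 0 < (radix L)%:R :> R by rewrite ltr0n radix_gt0.
rewrite -(ler_pM2l r0) divff ?gt_eqF// -{1}(gtr0_norm r0) -normrM mulrBr.
have := truncn_radix L x01; rewrite -(eq_code gx) -gd -truncn_radix// => E.
have t1 : 0 <= (radix L)%:R * x by case/andP: x01 => *; rewrite mulr_ge0// ltW.
have t2 : 0 <= (radix L)%:R * digact g x.
  by case/andP: g01 => *; rewrite mulr_ge0// ltW.
move: (truncn_itv t1) (truncn_itv t2); rewrite E mulrS => /andP[? ?] /andP[? ?].
by rewrite ler_norml; apply/andP; split; lra.
Qed.

End Action.

End Digits.

(** * Rigidity of sets and of square-integrable functions *)

Section SquareNorm.
Context d (X : measurableType d) (R : realType) (mu : probability X R).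
Implicit Types f g h : X -> R.

Definition sqn (h : X -> R) : \bar R := (\int[mu]_x ((h x) ^+ 2)%:E)%E.

Lemma measurable_sqr h : measurable_fun [set: X] h ->
  measurable_fun [set: X] (fun x => (h x ^+ 2)%:E).
Proof. by move=> mh; apply/measurable_EFinP; exact: measurable_funX. Qed.

Lemma sqn_ge0 h : (0 <= sqn h)%E.
Proof. by apply: integral_ge0 => x _; rewrite lee_fin sqr_ge0. Qed.

(** From (a + b)^2 + (a - b)^2 = 2 a^2 + 2 b^2. It serves as a triangle inequality for squared
    norms, valid without integrability. *)
Lemma sqnD_le f g : measurable_fun [set: X] f -> measurable_fun [set: X] g ->
  (sqn (fun x => f x + g x)%R <= 2%:E * sqn f + 2%:E * sqn g)%E.
Proof.
move=> mf mg; have [mf2 mg2] := (measurable_sqr mf, measurable_sqr mg).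
have sq0 h x : (0 <= ((h x : R) ^+ 2)%:E)%E by rewrite lee_fin sqr_ge0.
rewrite -!ge0_integralZl_EFin// -ge0_integralD//; try by
  [move=> x _; rewrite mule_ge0|exact: measurable_funeM].
apply: ge0_le_integral => //.
- by move=> x _; rewrite lee_fin sqr_ge0.
- by apply: (@measurable_sqr (fun x => f x + g x)); exact: measurable_funD.
- by apply: emeasurable_funD; exact: measurable_funeM.
- move=> x _; rewrite -!EFinM -EFinD lee_fin -subr_ge0.
  suff -> : 2 * f x ^+ 2 + 2 * g x ^+ 2 - (f x + g x) ^+ 2 = (f x - g x) ^+ 2.
    exact: sqr_ge0.
  by ring.
Qed.

Lemma sqnZ c h : measurable_fun [set: X] h ->
  sqn (fun x => c * h x) = ((c ^+ 2)%:E * sqn h)%E.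
Proof.
move=> mh; rewrite /sqn -ge0_integralZl_EFin ?sqr_ge0//.
- by apply: eq_integral => x _; rewrite exprMn EFinM.
- by move=> x _; rewrite lee_fin sqr_ge0.
- exact: measurable_sqr.
Qed.

Lemma sqn_comp (S : X -> X) h : measurable_fun [set: X] S ->
  (forall A, measurable A -> mu (S @^-1` A) = mu A) ->
  measurable_fun [set: X] h -> sqn (h \o S) = sqn h.
Proof.
move=> mS Smu mh.
rewrite /sqn -[RHS](@eq_measure_integral _ _ _ setT _ (pushforward mu S));
  last first.
  by move=> A mA _; exact: Smu.
rewrite ge0_integral_pushforward//; first exact: measurable_sqr.
by move=> x _; rewrite lee_fin sqr_ge0.
Qed.

Lemma Lnorm2_le h (e : R) : 0 <= e -> (sqn h <= (e ^+ 2)%:E)%E ->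
  ('N[mu]_2%:E[EFin \o h] <= e%:E)%E.
Proof.
move=> e0 he; rewrite unlock.
under eq_integral => x _ do rewrite /= powR_mulrn// -normrX ger0_norm
  ?sqr_ge0//.
rewrite (@le_trans _ _ (((e ^+ 2)%:E `^ 2^-1)%E))//.
  apply: gt0_ler_poweR => //; rewrite ?in_itv/= ?leey ?andbT//.
    exact: sqn_ge0.
  by rewrite lee_fin sqr_ge0.
by rewrite poweR_EFin -powR_mulrn// -powRrM mulfV ?pnatr_eq0// powRr1.
Qed.

Section RigidFunctions.
Variable T : nat -> X -> X.
Hypotheses (mT : forall n, measurable_fun [set: X] (T n))
  (Tmu : forall n A, measurable A -> mu (T n @^-1` A) = mu A).

Definition rigid_fun (f : X -> R) := forall e : R, 0 < e ->
  exists n0, forall n, (n0 <= n)%N -> (sqn (fun x => f (T n x) - f x)%R <=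
    e%:E)%E.

Definition rigid_set (A : set X) := forall e : R, 0 < e ->
  exists n0, forall n, (n0 <= n)%N -> (mu (T n @^-1` A `+` A) <= e%:E)%E.

Lemma measurable_comp_sub n f : measurable_fun [set: X] f ->
  measurable_fun [set: X] (fun x => f (T n x) - f x).
Proof.
by move=> mf; apply: measurable_funB => //; exact: (measurableT_comp mf (mT n)).
Qed.

Lemma rigid_funD f g : measurable_fun [set: X] f -> measurable_fun [set: X] g ->
  rigid_fun f -> rigid_fun g -> rigid_fun (fun x => f x + g x).
Proof.
move=> mf mg rf rg e e0; have e4 : 0 < e / 4 by rewrite divr_gt0.
have [[m hm] [m' hm']] := (rf _ e4, rg _ e4).
exists (maxn m m') => n; rewrite geq_max => /andP[/hm fn /hm' gn].
have -> : (fun x => f (T n x) + g (T n x) - (f x + g x)) =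
    (fun x => (f (T n x) - f x) + (g (T n x) - g x)).
  by apply/funext => x; rewrite opprD addrACA.
apply: le_trans (sqnD_le _ _) _; try exact: measurable_comp_sub.
have -> : e%:E = (2%:E * (e / 4)%:E + 2%:E * (e / 4)%:E)%E.
  by rewrite -!EFinM -EFinD; congr EFin; field.
by apply: leeD; rewrite lee_pmul2l.
Qed.

Lemma rigid_funZ c f : measurable_fun [set: X] f ->
  rigid_fun f -> rigid_fun (fun x => c * f x).
Proof.
move=> mf rf e e0; have c0 : 0 < c ^+ 2 + 1 by rewrite ltr_wpDl// sqr_ge0.
have [m hm] := rf _ (divr_gt0 e0 c0); exists m => n /hm fn.
under eq_fun do rewrite -mulrBr.
rewrite sqnZ; last exact: measurable_comp_sub.
apply: le_trans (lee_wpmul2l _ fn) _; first by rewrite lee_fin sqr_ge0.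
rewrite -EFinM lee_fin mulrA ler_pdivrMr// mulrC ler_pM2l// lerDl.
exact: ler01.
Qed.

Lemma rigid_fun_indic A : measurable A -> rigid_set A ->
  rigid_fun (\1_A : X -> R).
Proof.
move=> mA rA e /rA[m hm]; exists m => n /hm; apply: le_trans.
have mTA : measurable (T n @^-1` A) by rewrite -[_ @^-1` _]setTI; exact: mT.
have mTY : measurable (T n @^-1` A `+` A).
  by apply: measurableU; exact: measurableD.
rewrite -(setIT (T n @^-1` A `+` A)) -integral_indic// /sqn;
  apply: ge0_le_integral => //.
- by move=> x _; rewrite lee_fin sqr_ge0.
- by apply: measurable_sqr; apply: measurable_comp_sub; exact: measurable_indic.
- by apply/measurable_EFinP; exact: measurable_indic.
- move=> x _; rewrite lee_fin !indicE.
  have [TA|TA] := pselect (A (T n x)); have [Ax|Ax] := pselect (A x).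
  + by rewrite (mem_set TA) (mem_set Ax) subrr expr0n.
  + by rewrite (mem_set TA) (memNset Ax) mem_set ?subr0 ?expr1n//; left.
  + by rewrite (mem_set Ax) (memNset TA) mem_set ?sub0r ?sqrrN ?expr1n//; right.
  + by rewrite (memNset Ax) (memNset TA) subrr expr0n.
Qed.

Lemma rigid_fun_sum (I : Type) (s : seq I) (F : I -> X -> R) :
  (forall i, measurable_fun [set: X] (F i)) ->
  (forall i, rigid_fun (F i)) -> rigid_fun (fun x => \sum_(i <- s) F i x).
Proof.
move=> mF rF; elim: s => [|i s IH].
  move=> e e0; exists 0%N => n _.
  under eq_fun do rewrite !big_nil subrr.
  rewrite /sqn; under eq_integral do rewrite expr0n.
  by rewrite integral0 lee_fin ltW.
under eq_fun do rewrite big_cons.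
by apply: rigid_funD => //; exact: measurable_sum.
Qed.

(** Decompose f o T - f as (f - g) o T + (g o T - g) - (f - g); the outer terms have equal norm
    since T preserves the measure. *)
Lemma rigid_fun_approx f : measurable_fun [set: X] f ->
  (forall e : R, 0 < e -> exists g, [/\ measurable_fun [set: X] g, rigid_fun g &
     (sqn (fun x => f x - g x)%R <= e%:E)%E]) ->
  rigid_fun f.
Proof.
(* Two uses of [sqnD_le] cost a factor 2 (2 + 2) + 2 = 10. *)
move=> mf fg e e0; have e10 : 0 < e / 10 by rewrite divr_gt0.
have [g [mg rg gf]] := fg _ e10; have [m hm] := rg _ e10.
exists m => n /hm gn.
have mfg : measurable_fun [set: X] (fun x => f x - g x) by exact:
  measurable_funB.
have mfgT : measurable_fun [set: X] (fun x => f (T n x) - g (T n x)).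
  exact: (measurableT_comp mfg (mT n)).
have -> : (fun x => f (T n x) - f x) = (fun x =>
    ((f (T n x) - g (T n x)) + (g (T n x) - g x)) + -1 * (f x - g x)).
  by apply/funext => x; ring.
apply: le_trans (sqnD_le _ _) _.
- by apply: measurable_funD => //; exact: measurable_comp_sub.
- exact: measurable_funM.
rewrite sqnZ// sqrrN expr1n mul1e.
apply: (@le_trans _ _ (2%:E * (4 * (e / 10))%:E + 2%:E * (e / 10)%:E))%E;
  last first.
  by rewrite -!EFinM -EFinD lee_fin; lra.
apply: leeD; last by rewrite lee_pmul2l.
rewrite lee_pmul2l//; apply: le_trans (sqnD_le _ _) _ => //.
  exact: measurable_comp_sub.
have -> : (4 * (e / 10))%:E = (2%:E * (e / 10)%:E + 2%:E * (e / 10)%:E)%E.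
  by rewrite -!EFinM -EFinD; congr EFin; ring.
apply: leeD; rewrite lee_pmul2l//.
by rewrite (@sqn_comp (T n) (fun x => f x - g x))//; exact: Tmu.
Qed.

End RigidFunctions.
End SquareNorm.

(** * Closure properties of rigid sets *)

Section RigidSets.
Context d (X : measurableType d) (R : realType) (mu : probability X R).
Variable T : nat -> X -> X.
Hypotheses (mT : forall n, measurable_fun [set: X] (T n))
  (Tmu : forall n A, measurable A -> mu (T n @^-1` A) = mu A).

Local Notation rigid := (rigid_set mu T).

Let mTA n A : measurable A -> measurable (T n @^-1` A).
Proof. by move=> mA; rewrite -[_ @^-1` _]setTI; exact: mT. Qed.

Let mY (A B : set X) : measurable A -> measurable B -> measurable (A `+` B).
Proof. by move=> mA mB; apply: measurableU; exact: measurableD. Qed.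

Lemma rigid_setC A : rigid A -> rigid (~` A).
Proof.
move=> rA e /rA[m hm]; exists m => n /hm; congr (mu _ <= _)%E.
apply/seteqP; split => x /= [[a b]|[a b]]; [right|left|right|left]; split => //;
  exact: contrapT.
Qed.

Lemma rigid_set0 : rigid set0.
Proof.
move=> e e0; exists 0%N => n _.
by rewrite preimage_set0 setYK measure0 lee_fin ltW.
Qed.

(** With + the symmetric difference, T^-1 A + A is covered by T^-1 (A + J), T^-1 J + J and A + J,
    the first and last having equal measure. *)
Lemma rigid_set_approx A : measurable A ->
  (forall e : R, 0 < e -> exists J, [/\ measurable J, rigid J &
     (mu (A `+` J) <= e%:E)%E]) -> rigid A.
Proof.
move=> mA AJ e e0; have e3 : 0 < e / 3 by rewrite divr_gt0.
have [J [mJ rJ AJe]] := AJ _ e3; have [m hm] := rJ _ e3.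
exists m => n /hm Jn.
have mAJ := mY mA mJ; have mJJ := mY (mTA n mJ) mJ.
have sub : T n @^-1` A `+` A `<=`
    (T n @^-1` (A `+` J) `|` (T n @^-1` J `+` J)) `|` (A `+` J).
  move=> x /=; have [TJ|TJ] := pselect (J (T n x));
    have [Jx|Jx] := pselect (J x);
    by intuition.
apply: le_trans (le_measure _ _ _ sub) _; rewrite ?inE.
- by apply: mY => //; exact: mTA.
- by apply: measurableU => //; apply: measurableU => //; exact: mTA.
apply: le_trans (measureU2 _ _ _) _ => //.
  by apply: measurableU => //; exact: mTA.
have -> : e%:E = ((e / 3)%:E + (e / 3)%:E + (e / 3)%:E)%E.
  by rewrite -!EFinD; congr EFin; field.
apply: leeD => //; apply: le_trans (measureU2 _ _ _) _ => //.
  exact: mTA.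
apply: leeD => //; apply: le_trans AJe.
by have /eqP := Tmu n mAJ; rewrite eq_le => /andP[].
Qed.

Lemma rigid_setU A B : measurable A -> measurable B ->
  rigid A -> rigid B -> rigid (A `|` B).
Proof.
move=> mA mB rA rB e e0; have e2 : 0 < e / 2 by rewrite divr_gt0.
have [[m hm] [m' hm']] := (rA _ e2, rB _ e2).
exists (maxn m m') => n; rewrite geq_max => /andP[/hm An /hm' Bn].
have sub : T n @^-1` (A `|` B) `+` (A `|` B) `<=`
    (T n @^-1` A `+` A) `|` (T n @^-1` B `+` B).
  move=> x /=; have [?|?] := pselect (A (T n x));
  have [?|?] := pselect (A x); have [?|?] := pselect (B (T n x));
  have [?|?] := pselect (B x); by intuition.
have mAn := mY (mTA n mA) mA; have mBn := mY (mTA n mB) mB.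
apply: le_trans (le_measure _ _ _ sub) _; rewrite ?inE.
- by apply: mY; [apply: mTA|]; exact: measurableU.
- exact: measurableU.
apply: le_trans (measureU2 _ _ _) _ => //.
by rewrite [e]splitr EFinD; apply: leeD.
Qed.

(** The finite unions approximate the whole: the remainders decrease to the empty set, so their
    measures tend to 0. *)
Lemma rigid_bigcup (F : nat -> set X) : (forall k, measurable (F k)) ->
  (forall k, rigid (F k)) -> rigid (\bigcup_k F k).
Proof.
move=> mF rF; pose J K := \big[setU/set0]_(k < K) F k.
have mJ K : measurable (J K) by exact: bigsetU_measurable.
have rJ K : rigid (J K).
  rewrite /J; elim: K => [|K IH]; first by rewrite big_ord0; exact: rigid_set0.
  rewrite big_ord_recr/=; apply: rigid_setU => //.
  exact: bigsetU_measurable.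
have mU : measurable (\bigcup_k F k) by exact: bigcup_measurable.
apply: rigid_set_approx => // e e0.
pose D K := (\bigcup_k F k) `\` J K.
have mD K : measurable (D K) by exact: measurableD.
have D0 : \bigcap_K D K = set0.
  apply/seteqP; split => // x /= Dx.
  have [[k _ Fkx] _] := Dx 0%N I.
  have [_] := Dx k.+1 I; apply.
  by rewrite /J big_ord_recr/=; right.
have : mu \o D @ \oo --> mu (\bigcap_K D K).
  apply: nonincreasing_cvg_mu => //.
  - exact: le_lt_trans (probability_le1 _ (mD 0%N)) (ltry _).
  - by rewrite D0.
  - move=> a b ab; apply/subsetPset => x [Ux nJx]; split => // Jx; apply: nJx.
    exact: (@subset_bigsetU _ F a b ab).
rewrite D0 measure0 => /fine_cvgP[finD /cvgrPdist_le /(_ _ e0) Dlim].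
have [K _ [finK DK]] : exists2 K, True & (mu (D K) \is a fin_num) /\
    `|0 - fine (mu (D K))| <= e.
  near \oo => K; exists K => //; split; near: K; [exact: finD|exact: Dlim].
exists (J K); split => //.
have -> : (\bigcup_k F k) `+` J K = D K.
  rewrite /setY -/(D K) (_ : J K `\` _ = set0) ?setU0//.
  by apply/seteqP; split => // x [/(@bigsetU_bigcup _ F K)].
by rewrite -(fineK finK) lee_fin; move: DK; rewrite sub0r normrN;
  exact/le_trans/ler_norm.
Unshelve. all: by end_near. Qed.

End RigidSets.

(** * From rigid sets to square-integrable functions *)

Section RigidL2.
Context d (X : measurableType d) (R : realType) (mu : probability X R).
Variable T : nat -> X -> X.
Hypotheses (mT : forall n, measurable_fun [set: X] (T n))
  (Tmu : forall n A, measurable A -> mu (T n @^-1` A) = mu A)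
  (Trig : forall A, measurable A -> rigid_set mu T A).

Section StepApproximation.
Variables (f : X -> R) (mf : measurable_fun [set: X] f) (k : nat).

(** Maps the values of [f] in [-(k+1), k+1) to [0, 2 (k+1)^2), where unit intervals correspond to
    steps of height 1/(k+1) for [f]. *)
Let y (x : X) : R := k.+1%:R * (f x + k.+1%:R).

Let my : measurable_fun [set: X] y.
Proof. by apply: measurable_funM => //; exact: measurable_funD. Qed.

Let A (i : nat) : set X := [set x | i%:R <= y x < i.+1%:R].

(** Rounds [f] down to a multiple of 1/(k+1) where -(k+1) <= f < k+1, and is 0 elsewhere. *)
Definition step_fun (x : X) : R :=
  \sum_(0 <= i < 2 * k.+1 ^ 2) (i%:R / k.+1%:R - k.+1%:R) * \1_(A i) x.

Let mA i : measurable (A i).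
Proof.
have -> : A i = y @^-1` [set` `[i%:R, i.+1%:R[].
  by apply/seteqP; split => x; rewrite /A/= in_itv.
by rewrite -[_ @^-1` _]setTI; apply: my.
Qed.

Let mterm i : measurable_fun [set: X] (fun x => (i%:R / k.+1%:R - k.+1%:R) *
  (\1_(A i) x : R)).
Proof. by apply: measurable_funM => //; exact: measurable_indic. Qed.

Lemma measurable_step_fun : measurable_fun [set: X] step_fun.
Proof. exact: measurable_sum. Qed.

Lemma rigid_step_fun : rigid_fun mu T step_fun.
Proof.
apply: rigid_fun_sum => // i.
apply: rigid_funZ => //; try exact: measurable_indic.
by apply: rigid_fun_indic => //; exact: Trig.
Qed.

(** For dominated convergence in [rigid_fun_L2]: the first bound gives the dominating function, the
    second the pointwise limit. *)
Lemma step_fun_close x : `|f x - step_fun x| <= `|f x| + 1 /\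
  (`|f x| < k.+1%:R -> `|f x - step_fun x| <= k.+1%:R^-1).
Proof.
have k0 : 0 < k.+1%:R :> R by rewrite ltr0n.
have [/andP[y0 y1]|ny] := boolP (0 <= y x < (2 * k.+1 ^ 2)%:R); last first.
  have -> : step_fun x = 0.
    rewrite /step_fun big_nat big1// => i /andP[_ ik].
    rewrite indicE memNset ?mulr0// => /andP[i1 i2].
    move/negP: ny; apply; rewrite (le_trans _ i1)//= (lt_le_trans i2)//.
    by rewrite ler_nat.
  rewrite subr0; split; first by rewrite lerDl.
  rewrite ltr_norml => /andP[f1 f2]; case/negP: ny; rewrite /y; apply/andP;
    split.
    by rewrite mulr_ge0// -lerBlDr sub0r ltW.
  rewrite natrM natrX expr2 mulrCA ltr_pM2l//; lra.
have At : A (Num.truncn (y x)) x by exact: truncn_itv.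
have -> : step_fun x = (Num.truncn (y x))%:R / k.+1%:R - k.+1%:R.
  rewrite /step_fun (bigD1_seq (Num.truncn (y x))) ?iota_uniq//=; last first.
    by rewrite mem_index_iota/= truncn_lt_nat.
  rewrite indicE mem_set// mulr1 big1 ?addr0// => i it.
  rewrite indicE memNset ?mulr0// => Ai; move/eqP: it; apply.
  by apply/esym/eqP; rewrite truncn_eq.
have fE : f x = y x / k.+1%:R - k.+1%:R by rewrite /y mulrAC divff ?gt_eqF//
  mul1r addrK.
have le1 : `|f x - ((Num.truncn (y x))%:R / k.+1%:R - k.+1%:R)| <= k.+1%:R^-1.
  have ki : 0 <= k.+1%:R^-1 :> R by rewrite invr_ge0 ltW.
  have t0 : 0 <= y x - (Num.truncn (y x))%:R by rewrite subr_ge0; case/andP: At.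
  rewrite {1}fE opprB addrA subrK -mulrBl ger0_norm ?mulr_ge0//.
  rewrite ler_piMl// lerBlDl natr1 ltW//.
  by case/andP: At.
split => //; apply: (le_trans le1); rewrite ler_wpDl// invf_le1//.
by rewrite ler1n.
Qed.

End StepApproximation.

Lemma rigid_fun_L2 (f : X -> R) : f \in Lfun mu 2%:E -> rigid_fun mu T f.
Proof.
move=> f2; have mf : measurable_fun [set: X] f.
  by have := sub_Lfun_mfun f2; rewrite inE.
apply: rigid_fun_approx => // e e0.
have if2 := Lfun2_integrable_sqr f2.
(* 2 f^2 + 2 dominates (|f| + 1)^2, hence the squared error of every step function. *)
have ig : mu.-integrable [set: X] (fun x => (2%:E * ((f x) ^+ 2)%:E + (2 :
  R)%:E)%E).
  apply: integrableD => //; first exact: integrableZl.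
  exact: finite_measure_integrable_cst.
have mfs k : measurable_fun [set: X] (fun x => f x - step_fun f k x).
  by apply: measurable_funB => //; exact: measurable_step_fun.
have : (sqn mu (fun x => f x - step_fun f k x)%R) @[k --> \oo] -->
    (\int[mu]_(x in [set: X]) (cst 0 x))%E.
  apply: (dominated_cvg measurableT _ _ _ ig) => //.
  - move=> k; exact: measurable_sqr.
  - move=> x _; apply/fine_cvgP; split; first by near=> k.
    apply/cvgrPdist_le => e' e'0; near=> k; rewrite /= sub0r normrN normrX.
    have [_] := step_fun_close f k x.
    have kf : `|f x| < k.+1%:R.
      rewrite (lt_le_trans (truncnS_gt _))// ler_nat ltnS.
      by near: k; exact: nbhs_infty_ge.
    move=> /(_ kf) fk; have k0 : 0 < k.+1%:R :> R by rewrite ltr0n.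
    apply: (@le_trans _ _ k.+1%:R^-1).
      have f1 : `|f x - step_fun f k x| <= 1.
        by rewrite (le_trans fk)// invf_le1// ler1n.
      by rewrite expr2 (le_trans _ fk)// ler_piMr.
    apply: ltW; near: k; exact: (near_infty_natSinv_lt (PosNum e'0)).
  - move=> k x _; rewrite -EFinM -EFinD lee_fin normrX.
    have [fk _] := step_fun_close f k x.
    apply: (@le_trans _ _ ((`|f x| + 1) ^+ 2));
      first by rewrite ler_sqr ?nnegrE.
    rewrite -(real_normK (num_real (f x))) -subr_ge0.
    suff -> : 2 * `|f x| ^+ 2 + 2 - (`|f x| + 1) ^+ 2 = (`|f x| - 1) ^+ 2.
      exact: sqr_ge0.
    by ring.
rewrite integral0 => /fine_cvgP[finI /cvgrPdist_le /(_ _ e0) Ilim].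
near \oo => k; exists (step_fun f k); split.
- exact: measurable_step_fun.
- exact: rigid_step_fun.
- have fin : sqn mu (fun x => f x - step_fun f k x) \is a fin_num.
    by near: k; exact: finI.
  rewrite -(fineK fin) lee_fin; apply: (le_trans (ler_norm _)).
  rewrite -normrN -sub0r.
  by near: k; exact: Ilim.
Unshelve. all: by end_near. Qed.

Lemma rigid_L2 (f : X -> R) : f \in Lfun mu 2%:E ->
  'N[mu]_2%:E[EFin \o (f \o T n \- f)%R]%E @[n --> \oo] --> 0%E.
Proof.
move=> f2; have rf := rigid_fun_L2 f2.
have key (e : R) : 0 < e -> \forall n \near \oo,
    ('N[mu]_2%:E[EFin \o (f \o T n \- f)%R] <= e%:E)%E.
  move=> e0; have [m hm] := rf _ (exprn_gt0 2 e0).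
  near=> n; apply: Lnorm2_le; first exact: ltW.
  by apply: hm; near: n; exact: nbhs_infty_ge.
apply/fine_cvgP; split.
  apply: filterS (key 1 ltr01) => n n1.
  by rewrite ge0_fin_numE ?Lnorm_ge0// (le_lt_trans n1) ?ltry.
apply/cvgrPdist_le => e e0; apply: filterS (key e e0) => n n1 /=.
rewrite sub0r normrN ger0_norm ?fine_ge0 ?Lnorm_ge0//.
by rewrite -lee_fin fineK// ge0_fin_numE ?Lnorm_ge0// (le_lt_trans n1) ?ltry.
Unshelve. all: by end_near. Qed.

End RigidL2.

(** * Maps close to the identity off small sets *)

Section Close.
Variables (R : realType) (T : nat -> R -> R).
Local Notation mu := (@leb01 R : probability (lline R) R).
Hypotheses (Tmu : forall n (A : set (lline R)), measurable A ->
  measurable (T n @^-1` A : set (lline R)) /\ leb01 (T n @^-1` A) = leb01 A)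
  (Tclose : forall e e' : R, 0 < e -> 0 < e' -> exists n0, forall n, (n0 <=
    n)%N ->
    exists E : set (lline R), [/\ measurable E, (leb01 E <= e'%:E)%E &
      forall x, 0 <= x < 1 -> ~ E x -> `|T n x - x| <= e]).

Let mT n : @measurable_fun _ _ (lline R) (lline R) [set: _] (T n).
Proof. by move=> _ A mA; rewrite setTI; exact: (Tmu n mA).1. Qed.

(** A point of [0, 1) off [E] moves by at most e/5, so it can enter or leave the interval only
    within e/5 of an endpoint. Thus [E] costs e/5 and each endpoint 2e/5. *)
Lemma rigid_itv (a b : R) : rigid_set mu T [set` `]a, b]].
Proof.
move=> e e0; have e5 : 0 < e / 5 by rewrite divr_gt0.
have [m hm] := Tclose e5 e5; exists m => n /hm[E [mE E5 TE]].
pose N c : set (lline R) := [set` `[c - e / 5, c + e / 5[] `|` [set` `[c + e /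
  5, c + e / 5]].
have mN c : measurable (N c) by apply: measurableU; exact: itv_lmeasurable.
have muN c : (leb01 (N c) <= (e / 5 + e / 5)%:E)%E.
  apply: (@le_trans _ _ (completed_lebesgue_measure (N c))).
    apply: le_measure; rewrite ?inE//.
    by apply: measurableI => //; exact: itv_lmeasurable.
  apply: le_trans (measureU2 _ _ _) _; try exact: itv_lmeasurable.
  have h0 : completed_lebesgue_measure [set` `[c + e / 5, c + e / 5]] = 0%E.
    by transitivity (lebesgue_measure [set` `[c + e / 5, c + e / 5]]);
      [by []|rewrite lebesgue_measure_itv/= ltxx].
  have h1 : completed_lebesgue_measure [set` `[c - e / 5, c + e / 5[] = (e / 5
    + e / 5)%:E.
    by rewrite completed_lebesgue_itv; [congr EFin; ring|lra].
  by rewrite [X in (_ + X <= _)%E]h0 [X in (X + _ <= _)%E]h1 adde0.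
set S := T n @^-1` _ `+` _.
pose O : set (lline R) := ~` [set` `[0, 1[].
have mO : measurable O by apply: measurableC; exact: itv_lmeasurable.
have O0 : leb01 O = 0%E by rewrite /leb01 /mrestr setICl; exact: measure0.
have mS : measurable (S : set (lline R)).
  have mi := @itv_lmeasurable R `]a, b]; have [mTi _] := Tmu n mi.
  by apply: measurableU; exact: measurableD.
have sub : S `<=` (E `|` (N a `|` N b)) `|` O.
  move=> x Sx; have [x01|x01] := boolP (0 <= x < 1); last first.
    by right; rewrite /O/= in_itv/=; exact/negP.
  left; have [Ex|/(TE x x01)] := pselect (E x); first by left.
  move=> Tx; right; apply: contrapT => /not_orP[Na Nb].
  have {}Na : ~ (a - e / 5 <= x <= a + e / 5).
    move=> /andP[h1]; rewrite le_eqVlt => h2; apply: Na; rewrite /N/= !in_itv/=.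
    by case/orP: h2 => [/eqP ->|h2]; [right; rewrite lexx|left; rewrite h1].
  have {}Nb : ~ (b - e / 5 <= x <= b + e / 5).
    move=> /andP[h1]; rewrite le_eqVlt => h2; apply: Nb; rewrite /N/= !in_itv/=.
    by case/orP: h2 => [/eqP ->|h2]; [right; rewrite lexx|left; rewrite h1].
  move: Tx; rewrite ler_norml => /andP[h1 h2].
  have {}Na : (x < a - e / 5) \/ (a + e / 5 < x).
    by apply/orP; rewrite !ltNge -negb_and; exact/negP.
  have {}Nb : (x < b - e / 5) \/ (b + e / 5 < x).
    by apply/orP; rewrite !ltNge -negb_and; exact/negP.
  move: Sx; rewrite /S/= !in_itv/=.
  have -> : (a < T n x) = (a < x).
    by apply/idP/idP => ?; case: Na => ?; lra.
  have -> : (T n x <= b) = (x <= b).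
    by apply/idP/idP => ?; case: Nb => ?; lra.
  by move=> [[]|[]].
have mNN : measurable (N a `|` N b : set (lline R)) by exact: measurableU.
have mENN : measurable (E `|` (N a `|` N b) : set (lline R)) by exact:
  measurableU.
apply: (@le_trans _ _ (mu ((E `|` (N a `|` N b)) `|` O))).
  by apply: le_measure; rewrite ?inE//; exact: measurableU.
apply: le_trans (measureU2 _ _ _) _ => //.
rewrite [X in (_ + X)%E]O0 adde0.
apply: le_trans (measureU2 _ _ _) _ => //.
have -> : e%:E = ((e / 5)%:E + ((e / 5 + e / 5)%:E + (e / 5 + e / 5)%:E))%E.
  by rewrite -!EFinD; congr EFin; field.
apply: leeD => //; apply: le_trans (measureU2 _ _ _) _ => //.
by apply: leeD; exact: muN.
Qed.

(** The measurable rigid sets form a sigma-algebra containing the half-open intervals, hence all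
    Borel sets; a Lebesgue measurable set differs from a Borel set by a null set. *)
Lemma rigid_leb01 (A : set (lline R)) : measurable A -> rigid_set mu T A.
Proof.
have Tmu' n (B : set (lline R)) : measurable B -> mu (T n @^-1` B) = mu B.
  by move=> mB; exact: (Tmu n mB).2.
have borel : (R.-ocitv.-measurable).-sigma.-measurable `<=`
    [set B | measurable (B : set (lline R)) /\ rigid_set mu T B].
  apply: smallest_sub.
    split => /=.
    - by split => //; exact: rigid_set0.
    - move=> B [mB rB]; rewrite setTD; split; first exact: measurableC.
      exact: rigid_setC.
    - move=> F mrF; split; first by apply: bigcup_measurable => k _;
      exact: (mrF k).1.
      by apply: rigid_bigcup => // k; [exact: (mrF k).1|exact: (mrF k).2].
  move=> B /ocitvP[->|[[a b] ab ->]]; split; try exact: measurable0.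
  - exact: rigid_set0.
  - exact: itv_lmeasurable.
  - exact: rigid_itv.
move=> mA; have : ((wlength (@idfun R))^*%mu.-cara.-measurable A) := mA.
rewrite -completed_caratheodory_measurable g_sigma_completed_algebra_genE.
move: A mA => _ _ [B mB [N [M [mM M0 NM]] <-]].
have [mB' rB] := borel _ mB.
have mM' : measurable (M : set (lline R)) by exact: sub_caratheodory.
have mN : measurable (N : set (lline R)).
  apply: completed_lebesgue_measure_is_complete; exists M; split => //.
apply: rigid_set_approx => //; first exact: measurableU.
move=> e e0; exists B; split => //.
have N0 : mu N = 0%E.
  apply/eqP; rewrite eq_le measure_ge0 andbT.
  apply: (@le_trans _ _ (completed_lebesgue_measure M)).
    apply: le_measure; rewrite ?inE//.
      by apply: measurableI => //; exact: itv_lmeasurable.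
    by apply: subset_trans NM; exact: subIsetl.
  by rewrite [X in (X <= _)%E](_ : _ = lebesgue_measure M)// M0.
apply: (@le_trans _ _ (mu N)); last by rewrite N0 lee_fin ltW.
apply: le_measure; rewrite ?inE//.
  by apply: measurableU; apply: measurableD => //; exact: measurableU.
by move=> x [[[]//]|[Bx /not_orP[]//]].
Qed.

Lemma rigid_leb01_L2 (f : lline R -> R) : f \in Lfun mu 2%:E ->
  'N[mu]_2%:E[EFin \o (f \o T n \- f)%R]%E @[n --> \oo] --> 0%E.
Proof.
apply: rigid_L2 => //.
- by move=> n A mA; exact: (Tmu n mA).2.
- exact: rigid_leb01.
Qed.

End Close.

(** * Recurrence through concentration of measure *)

Section Concentration.
Variables (R : realFieldType) (A : finType).

Definition hamming n (x y : {ffun 'I_n -> A}) : nat := \sum_i (x i != y i).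

Lemma hamming_xx n (x : {ffun 'I_n -> A}) : hamming x x = 0%N.
Proof. by rewrite /hamming big1// => i _; rewrite eqxx. Qed.

Lemma hammingC n (x y : {ffun 'I_n -> A}) : hamming x y = hamming y x.
Proof. by apply: eq_bigr => i _; rewrite eq_sym. Qed.

Lemma hamming_triangle n (y x z : {ffun 'I_n -> A}) :
  (hamming x z <= hamming x y + hamming y z)%N.
Proof.
rewrite /hamming -big_split leq_sum// => i _ /=.
have [->|_] := eqVneq (x i) (y i); first by rewrite leqnn.
by rewrite (leq_trans (leq_b1 _)).
Qed.

Definition fcons n (a : A) (p : {ffun 'I_n -> A}) : {ffun 'I_n.+1 -> A} :=
  [ffun i => if unlift ord0 i is Some j then p j else a].

Lemma hamming_fcons n a b (p p' : {ffun 'I_n -> A}) :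
  hamming (fcons a p) (fcons b p') = ((a != b) + hamming p p')%N.
Proof.
rewrite /hamming big_ord_recl !ffunE unlift_none; congr addn.
by apply: eq_bigr => i _; rewrite !ffunE liftK.
Qed.

Lemma sum_fcons n (F : {ffun 'I_n.+1 -> A} -> R) :
  \sum_x F x = \sum_a \sum_p F (fcons a p).
Proof.
rewrite pair_bigA /= (reindex (fun u : A * {ffun 'I_n -> A} => fcons u.1
  u.2))//=.
exists (fun x => (x ord0, [ffun j => x (lift ord0 j)])) => [[a p] _|x _] /=.
  rewrite ffunE unlift_none; congr pair; apply/ffunP => j.
  by rewrite !ffunE liftK.
by apply/ffunP => i; rewrite ffunE; case: unliftP => [j ->|->]; rewrite ?ffunE.
Qed.

(** Up to normalisation the right-hand side is a variance, so that bounding the pairwise differences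
    of [s] bounds its variance. *)
Lemma sum_sqr_sub (I : finType) (s : I -> R) :
  \sum_a \sum_b (s a - s b) ^+ 2 =
  2 * (#|I|%:R * \sum_a s a ^+ 2 - (\sum_a s a) ^+ 2).
Proof.
have inner a : \sum_b (s a - s b) ^+ 2 =
    #|I|%:R * s a ^+ 2 + \sum_b s b ^+ 2 - 2 * s a * \sum_b s b.
  rewrite (eq_bigr (fun b => s a ^+ 2 + s b ^+ 2 - 2 * s a * s b)).
    by rewrite sumrB big_split/= sumr_const -mulr_sumr -(mulr_natl (s a ^+ 2)).
  by move=> b _; ring.
rewrite (eq_bigr _ (fun a _ => inner a)) sumrB big_split/= sumr_const.
by rewrite -mulr_suml -!mulr_sumr -mulr_natl; ring.
Qed.

(* The left-hand side is the square of the cardinal of the space times the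
   variance of f for the uniform probability. *)
Lemma variance_lipschitz n (f : {ffun 'I_n -> A} -> R) :
  (forall x y, `|f x - f y| <= (hamming x y)%:R) ->
  #|A|%:R ^+ n * (\sum_x f x ^+ 2) - (\sum_x f x) ^+ 2
    <= n%:R * (#|A|%:R ^+ n) ^+ 2.
Proof.
elim: n f => [|n IH] f fL.
  have c1 : #|{ffun 'I_0 -> A}| = 1%N by rewrite card_ffun card_ord expn0.
  have [x0 x0P] := mem_card1 c1.
  have sum1 (F : {ffun 'I_0 -> A} -> R) : \sum_x F x = F x0.
    rewrite (bigD1 x0)//= big1 ?addr0// => x.
    by have := x0P x; rewrite !inE => /esym/eqP ->; rewrite eqxx.
  by rewrite !sum1 expr0 mul1r mul0r subrr.
rewrite !sum_fcons; set q := #|A|%:R : R; set m := q ^+ n.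
(* Law of total variance along the first letter: [h1] bounds the variance inside each fibre by
   induction, [h2] that of the fibre sums [s a], which differ pairwise by at most [m]. *)
pose s a := \sum_p f (fcons a p).
have mE : m = \sum_(p : {ffun 'I_n -> A}) 1.
  by rewrite sumr_const card_ffun card_ord natrX.
have m0 : 0 <= m by rewrite exprn_ge0.
have sL a b : (s a - s b) ^+ 2 <= m ^+ 2.
  rewrite -(real_normK (num_real (_ - _))) ler_sqr ?nnegrE// /s -sumrB mE.
  apply: le_trans (ler_norm_sum _ _ _) _; apply: ler_sum => p _.
  apply: le_trans (fL _ _) _; rewrite hamming_fcons hamming_xx addn0.
  by case: (_ != _).
have h1 a : m * (\sum_p f (fcons a p) ^+ 2) - s a ^+ 2 <= n%:R * m ^+ 2.
  apply: (IH (fun p => f (fcons a p))) => x y.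
  by have := fL (fcons a x) (fcons a y); rewrite hamming_fcons eqxx.
have h2 : 2 * (q * \sum_a s a ^+ 2 - (\sum_a s a) ^+ 2) <= q ^+ 2 * m ^+ 2.
  rewrite -sum_sqr_sub; apply: (@le_trans _ _ (\sum_(a : A) \sum_(b : A) m ^+
    2)).
    by apply: ler_sum => a _; apply: ler_sum => b _.
  by rewrite !sumr_const -mulrnA -mulr_natl natrM expr2.
have h3 : m * (\sum_a \sum_p f (fcons a p) ^+ 2) - \sum_a s a ^+ 2
    <= q * (n%:R * m ^+ 2).
  rewrite mulr_sumr -sumrB; apply: le_trans (ler_sum _ (fun a _ => h1 a)) _.
  by rewrite sumr_const -[leLHS]mulr_natl.
have q0 : 0 <= q by exact: ler0n.
have := ler_wpM2l q0 h3; rewrite (exprS q n) -/m -natr1.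
set S1 := \sum_a _; set S2 := \sum_a s a ^+ 2.
rewrite -/(\sum_a s a) in h2 *.
set S3 := \sum_a s a in h2 *.
have : 0 <= q ^+ 2 * m ^+ 2 by rewrite mulr_ge0// sqr_ge0.
rewrite -/S2 in h2; move: h2.
move=> h4 h5 h6; nra.
Qed.

End Concentration.

(** * Differences of dense subsets of a power of A *)

Section Doubling.
Variables (A : finZmodType) (one : A).

Definition defects n (x : {ffun 'I_n -> A}) : nat := \sum_i (x i != one).

(** The distance to [B] is 1-Lipschitz, so it concentrates: it cannot vanish on [B] and exceed 4 w^2
    on the translate of [B] by [one]. The length n = 4 w^3 makes the Chebyshev deviation sqrt(n w)
    equal to 2 w^2, half of the n / w defects allowed. *)
Lemma dense_difference (w : nat) (B : {set {ffun 'I_(4 * w ^ 3) -> A}}) :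
  (0 < w)%N -> (#|{ffun 'I_(4 * w ^ 3) -> A}| <= w * #|B|)%N ->
  exists b b', [/\ b \in B, b' \in B & (w * defects (b' - b)%R <= 4 * w ^ 3)%N].
Proof.
set n := (4 * w ^ 3)%N => w0 Bd; apply: contrapT => noB.
pose R := rat.
have A0 : (0 < #|A|)%N by apply/card_gt0P; exists 0.
pose M : R := #|A|%:R ^+ n.
have M0 : 0 < M by rewrite exprn_gt0// ltr0n.
have ME : (#|{ffun 'I_n -> A}|)%:R = M by rewrite card_ffun card_ord natrX.
have BM : M <= w%:R * #|B|%:R by rewrite -ME -natrM ler_nat.
have [b0 b0B] : exists b0, b0 \in B.
  apply/set0Pn; rewrite -card_gt0 lt0n; apply/eqP => B0; move: BM.
  by rewrite B0 mulr0 leNgt M0.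
pose near x := [arg min_(b < b0 in B) hamming x b].
pose f x : R := (hamming x (near x))%:R.
have nearB x : near x \in B by rewrite /near; case: arg_minnP.
have near_le x b : b \in B -> (hamming x (near x) <= hamming x b)%N.
  by rewrite /near; case: arg_minnP => // c _; apply.
have f_le x y : f x <= f y + (hamming x y)%:R.
  rewrite /f -natrD ler_nat (leq_trans (near_le x _ (nearB y)))//.
  by rewrite addnC hamming_triangle.
have fL x y : `|f x - f y| <= (hamming x y)%:R.
  have := f_le x y; have := f_le y x; rewrite (hammingC y x) ler_norml.
  by move=> *; apply/andP; split; lra.
pose S1 := \sum_x f x; pose E := S1 / M.
have S1E : S1 = E * M by rewrite /E divfK// gt_eqF.
(* By Chebyshev's inequality a set of density at least 1/w contains a point x
   with |f x - E| <= 2 w^2; this is applied to B, where f = 0, and to its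
   translate by one, where f counts defects. *)
have sumE : \sum_x (f x - E) ^+ 2 <= n%:R * M.
  have -> : \sum_x (f x - E) ^+ 2 = \sum_x f x ^+ 2 - 2 * E * S1 + M * E ^+ 2.
    rewrite (eq_bigr (fun x => f x ^+ 2 - 2 * E * f x + E ^+ 2)).
      by rewrite big_split sumrB/= -mulr_sumr sumr_const -[E ^+ 2 *+
        _]mulr_natl ME.
    by move=> x _; ring.
  have := variance_lipschitz fL; rewrite -/n -/M -/S1 S1E => var.
  rewrite -(ler_pM2l M0); move: var; set S2 := \sum_x f x ^+ 2. lra.
have subE (S : {set {ffun 'I_n -> A}}) : \sum_(x in S) (f x - E) ^+ 2 <= n%:R *
  M.
  apply: le_trans sumE; rewrite [leRHS](bigID (mem S))/= lerDl.
  by apply: sumr_ge0 => x _; rewrite sqr_ge0.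
have E0 : 0 <= E by rewrite divr_ge0 ?sumr_ge0// ltW.
have wR0 : 0 < w%:R :> R by rewrite ltr0n.
have w2 : 0 <= w%:R ^+ 2 :> R by rewrite exprn_ge0// ltW.
have cardE (S : {set {ffun 'I_n -> A}}) (c : R) : #|S| = #|B| ->
   (forall x, x \in S -> c <= (f x - E) ^+ 2) -> c <= 4 * w%:R ^+ 4.
  move=> SB cS; have h : #|B|%:R * c <= n%:R * M.
    apply: le_trans (subE S); rewrite -SB mulr_natl -sumr_const.
    exact: ler_sum.
  have B0 : 0 < #|B|%:R :> R by rewrite ltr0n; apply/card_gt0P; exists b0.
  rewrite -(ler_pM2l B0); apply: (le_trans h).
  apply: le_trans (ler_wpM2l _ BM) _; first exact: ler0n.
  by rewrite /n natrM natrX le_eqVlt; apply/orP; left; apply/eqP; ring.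
have E2 : E <= 2 * w%:R ^+ 2.
  have w4 : 0 <= 2 * w%:R ^+ 2 :> R by lra.
  rewrite -(@ler_sqr R) ?nnegrE//.
  have -> : (2 * w%:R ^+ 2) ^+ 2 = 4 * w%:R ^+ 4 :> R by ring.
  apply: (cardE B (E ^+ 2)) => // b bB.
  have -> : f b = 0.
    by have := near_le b b bB; rewrite hamming_xx leqn0 /f => /eqP ->.
  by rewrite sub0r sqrrN.
pose sh (x : {ffun 'I_n -> A}) := x + [ffun=> one].
have : (2 * w%:R ^+ 2 + 1) ^+ 2 <= 4 * w%:R ^+ 4 :> R.
  apply: (@cardE (sh @: B)); first by rewrite card_imset//; exact: addIr.
  move=> _ /imsetP[b bB ->].
  (* Otherwise the point of [B] nearest to [sh b] differs from [b] by an element with at most 4 w^2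
     defects, against [noB]. *)
  have fb : 4 * w%:R ^+ 2 + 1 <= f (sh b).
    rewrite /f -natrX -natrM natr1 ler_nat ltnNge; apply/negP => small.
    apply: noB; exists b, (near (sh b)); split => //.
    have -> : defects (near (sh b) - b) = hamming (sh b) (near (sh b)).
      apply: eq_bigr => i _; rewrite !ffunE; congr (~~ _ : nat).
      by rewrite subr_eq addrC eq_sym.
    by rewrite -(leq_pmul2l w0) in small;
      rewrite (leq_trans small)// mulnCA -expnS.
  set W := w%:R ^+ 2 in w2 E2 fb *.
  have h1 : 0 <= 2 * W + 1 by lra.
  have h2 : 2 * W + 1 <= f (sh b) - E by lra.
  by rewrite ler_sqr ?nnegrE// (le_trans h1).
by move=> *; nra.
Qed.

End Doubling.

(** * A finitary criterion for recurrence *)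

Section Recurrence.
Variables (R : realType) (G : zmodType) (S : set G).

Definition finitely_recurrent (w : nat) :=
  exists (I : finType) (h : I -> G), (0 < #|I|)%N /\
    forall B : {set I}, (#|I| <= w * #|B|)%N ->
    exists b b', [/\ b \in B, b' \in B, S (h b' - h b) & h b' - h b != 0].

(** If recurrence failed for [A], then for almost every x the set of the b with T (h b) x in [A]
    would contain no good pair, hence have density at most 1/w. Integrating over x gives mu A <=
    1/w, while w is chosen above 1 / mu A. *)
Lemma set_of_recurrenceP : (forall w0, exists2 w, (w0 <= w)%N &
  finitely_recurrent w) ->
  set_of_recurrence R S.
Proof.
move=> Sfin d X mu T [_ [T0 TD] mT Tmu] A mA A0; apply: contrapT => noR.
have mTA g : measurable (T g @^-1` A) by rewrite -[_ @^-1` _]setTI; exact: mT.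
have finA : mu A \is a fin_num by exact: fin_num_measure.
pose a := fine (mu A); have aE : mu A = a%:E by rewrite fineK.
have a0 : 0 < a by rewrite -lte_fin -aE.
have [w ww [I [h [I0 hB]]]] := Sfin (Num.truncn a^-1).+1.
have wa : a^-1 < w%:R by rewrite (lt_le_trans (truncnS_gt _))// ler_nat.
pose good (u : I * I) := `[< S (h u.2 - h u.1) >] && (h u.2 - h u.1 != 0).
pose Zu (u : I * I) := if good u then T (h u.1) @^-1` A `&` T (h u.2) @^-1` A
  else set0.
have mZu u : measurable (Zu u).
  by rewrite /Zu; case: ifP => // _; exact: measurableI.
(* By invariance the overlap for a good pair (b, b') has the measure of the intersection of [A] with
   its preimage by T (h b' - h b). *)
have Zu0 u : mu (Zu u) = 0%E.
  rewrite /Zu; case: ifP => [/andP[/asboolP Su nu]|_]; last exact: measure0.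
  apply: contrapT => nz; apply: noR; exists (h u.2 - h u.1); split => //.
  have mAT : measurable (A `&` T (h u.2 - h u.1) @^-1` A) by exact: measurableI.
  rewrite lt0e measure_ge0 andbT; apply/eqP; rewrite -(Tmu (h u.1))// => z.
  apply: nz; rewrite -z; congr (mu _); apply/seteqP.
  by rewrite preimage_setI -comp_preimage -TD subrK; split.
pose Z := \big[setU/set0]_u Zu u.
have mZ : measurable Z by exact: bigsetU_measurable.
have Z0 : mu Z = 0%E.
  apply/eqP; rewrite eq_le measure_ge0 andbT /Z.
  elim: (index_enum _) => [|u s IH]; first by rewrite big_nil measure0.
  rewrite big_cons; apply: le_trans (measureU2 _ _ _) _ => //.
    exact: bigsetU_measurable.
  by rewrite -[leRHS]adde0; apply: leeD => //; rewrite le_eqVlt; apply/orP;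
    left; apply/eqP; exact: Zu0.
pose Ab b := T (h b) @^-1` A.
have mAb b : measurable (Ab b) by exact: mTA.
have w0 : 0 < w%:R :> R by apply: lt_trans wa; rewrite invr_gt0.
have count x : \sum_b \1_(Ab b) x <= #|I|%:R / w%:R + #|I|%:R * \1_Z x :> R.
  have [Zx|Zx] := pselect (Z x).
    rewrite [\1_Z x]indicE mem_set// mulr1 ler_wpDl ?divr_ge0 ?ler0n//.
    have -> : #|I|%:R = \sum_(b : I) 1 :> R by rewrite sumr_const.
    apply: ler_sum => b _.
    by rewrite indicE lern1 leq_b1.
  rewrite [\1_Z x]indicE memNset// mulr0 addr0 ler_pdivlMr//.
  pose B := [set b | x \in Ab b]%SET.
  have -> : \sum_b \1_(Ab b) x = #|B|%:R :> R.
    rewrite -sum1_card natr_sum [RHS]big_mkcond/=; apply: eq_bigr => b _.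
    by rewrite indicE inE; case: (_ \in _).
  rewrite -natrM ler_nat mulnC leqNgt; apply/negP => /ltnW /hB.
  move=> [b [b' [bB b'B Sb nb]]]; apply: Zx; rewrite /Z.
  rewrite -bigcup_seq; exists (b, b') => /=; first by rewrite mem_index_enum.
  rewrite /Zu /good/= nb andbT asboolT//.
  by move: bB b'B; rewrite !inE.
have : (\int[mu]_x (\sum_b (\1_(Ab b) x)%:E) <=
   \int[mu]_x ((#|I|%:R / w%:R : R)%:E + (#|I|%:R : R)%:E * (\1_Z x)%:E))%E.
  apply: ge0_le_integral => //.
  - by move=> x _; apply: sume_ge0 => b _; rewrite lee_fin.
  - apply: emeasurable_sum => b; apply/measurable_EFinP;
    exact: measurable_indic.
  - apply: emeasurable_funD => //; apply: measurable_funeM.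
    by apply/measurable_EFinP; exact: measurable_indic.
  - by move=> x _; rewrite sumEFin -EFinM -EFinD lee_fin.
rewrite ge0_integral_sum//; last first.
  by move=> b; apply/measurable_EFinP; exact: measurable_indic.
rewrite ge0_integralD//; last first.
  by apply: measurable_funeM; apply/measurable_EFinP; exact: measurable_indic.
rewrite ge0_integralZl_EFin//; last by apply/measurable_EFinP;
  exact: measurable_indic.
rewrite integral_indic// setIT [X in (_ + _ * X)%E]Z0 mule0 adde0.
rewrite integral_cst// [X in (_ <= _ * X)%E](probability_setT mu) mule1.
rewrite (eq_bigr (fun=> a%:E)); last first.
  by move=> b _; rewrite integral_indic// setIT -aE; exact: Tmu.
rewrite sumEFin lee_fin sumr_const -[a *+ _]mulr_natl ler_pM2l ?ltr0n//.
by apply/negP; rewrite -ltNge invf_plt// posrE.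
Qed.

End Recurrence.

(** Term n decodes n as a pair (m, i) and is entry i of [L m]; failing that it is [hd n], which lies
    in [L n]. The pairs with m < M have bounded codes, so late terms come from late lists. *)
Lemma enum_blocks (T : eqType) (L : nat -> seq T) (hd : nat -> T) :
  (forall m, hd m \in L m) ->
  exists r : nat -> T, (forall m x, x \in L m -> exists n, r n = x) /\
    (forall M, exists n0, forall n, (n0 <= n)%N ->
       exists2 m, (M <= m)%N & r n \in L m).
Proof.
move=> hdL.
pose r n := if pickle_inv n is Some (m, i) then
    if (i < size (L m))%N then nth (hd n) (L m) i else hd n else hd n.
exists r; split => [m x /(nthP (hd m))[i im <-]|M].
  exists (pickle (m, i)); rewrite /r pickleK_inv im.
  exact: set_nth_default.
pose B := (\max_(m < M) \max_(i < size (L m)) (pickle (m : nat, i : nat)).+1)%N.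
exists (maxn M B) => n; rewrite geq_max => /andP[Mn Bn]; rewrite /r.
case E : pickle_inv => [[m i]|]; last by exists n.
case: ifP => im; last by exists n.
exists m; last first.
  exact: mem_nth.
rewrite leqNgt; apply/negP => mM; move: Bn; rewrite leqNgt => /negP; apply.
have := @pickle_invK (nat * nat)%type n; rewrite E /= => <-.
apply: (@leq_trans (\max_(i < size (L m)) (pickle (m, i : nat)).+1)%N).
  exact: (@leq_bigmax _ (fun j : 'I_(size (L m)) => (pickle (m, j : nat)).+1)
    (Ordinal im)).
exact: (@leq_bigmax _ (fun k : 'I_M => \max_(j < size (L k)) (pickle (k : nat,
  j : nat)).+1)%N (Ordinal mM)).
Qed.

(** * Blocks and transvections *)

(** The length in [dense_difference] for density 1/(m+1); block m starts at [pos m]. *)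
Definition blk (m : nat) : nat := (4 * m.+1 ^ 3)%N.
Definition pos (m : nat) : nat := (\sum_(l < m) blk l)%N.

Lemma blk_gt0 m : (0 < blk m)%N.
Proof. by rewrite muln_gt0 expn_gt0. Qed.

Lemma posS m : pos m.+1 = (pos m + blk m)%N.
Proof. by rewrite /pos big_ord_recr. Qed.

Lemma leq_pos m : (m <= pos m)%N.
Proof.
elim: m => // m IH; rewrite posS -addn1 leq_add//; exact: blk_gt0.
Qed.

Lemma pos_homo m m' : (m <= m')%N -> (pos m <= pos m')%N.
Proof.
move=> /subnK <-; elim: (m' - m)%N => // k IH.
by rewrite addSn posS (leq_trans IH)// leq_addr.
Qed.

Section Transvections.
Variables (A : zmodType) (one : A) (mul : A -> A -> A).
Hypotheses (mulDl : forall x y v, mul (x + y) v = mul x v + mul y v)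
  (mul_one : forall v, mul one v = v) (mul0r : forall x, mul x 0 = 0).

Let mulr0l v : mul 0 v = 0.
Proof. by apply: (addrI (mul 0 v)); rewrite -mulDl !addr0. Qed.

Definition below (M : nat) (v : nat -> A) := forall n, (M <= n)%N -> v n = 0.

Definition transvect (u : nat -> A) (i : nat) (v : nat -> A) : nat -> A :=
  fun n => v n + mul (v i) (u n).

Variable u : nat -> nat -> A.
Hypothesis u_below : forall m, below (pos m) (u m).
Implicit Type w : nat -> nat.

(** The transvection of largest index acts first; that of index m reads position [pos m + w m] and,
    by [u_below], changes only positions before block m. *)
Fixpoint phi w (M : nat) (v : nat -> A) : nat -> A :=
  if M is m.+1 then phi w m (transvect (u m) (pos m + w m) v) else v.

Lemma phiD w M v v' : phi w M (v + v') = phi w M v + phi w M v'.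
Proof.
elim: M v v' => //= M IH v v'; rewrite -IH; congr (phi w M _).
by apply/funext => n; rewrite /transvect !fctE mulDl addrACA.
Qed.

Lemma phi_below w M v : below (pos M) v -> below (pos M) (phi w M v).
Proof.
move=> vM n; have : (pos M <= n)%N -> v n = 0 by exact: vM.
elim: M v {vM} => [v|M IH v vn Mn] /=; first by [].
apply: IH; last by rewrite (leq_trans _ Mn)// pos_homo.
move=> _; rewrite /transvect vn// u_below ?mul0r ?addr0//.
by rewrite (leq_trans _ Mn)// pos_homo.
Qed.

(** The factors of index at least [M] read positions where [v] vanishes. *)
Lemma phi_level w M M' v : below (pos M) v -> (M <= M')%N ->
  phi w M' v = phi w M v.
Proof.
move=> vM /subnK <-; elim: (M' - M)%N => // k IH.
rewrite addSn /= -IH; congr (phi w _ _); apply/funext => n.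
rewrite /transvect (vM (_ + _)%N) ?mulr0l ?addr0//.
by rewrite (@leq_trans (pos (k + M)))// ?leq_addr// pos_homo// leq_addl.
Qed.

(** A transvection does not change the entry it reads, as [u M] vanishes there; if the result is 0,
    that entry was 0 and nothing was added. *)
Lemma phi_inj w M v : (forall n, phi w M v n = 0) -> forall n, v n = 0.
Proof.
elim: M v => //= M IH v /IH; rewrite /transvect => v0 n.
have vi : v (pos M + w M)%N = 0.
  by have := v0 (pos M + w M)%N; rewrite (u_below (leq_addr _ _)) mul0r addr0.
by have := v0 n; rewrite vi mulr0l addr0.
Qed.

Lemma phi_block w M v : (forall l, (l < M)%N -> (w l < blk l)%N) ->
  (forall n, (n < pos M)%N -> v n = 0) -> phi w M v = v.
Proof.
elim: M => //= M IH wM vM.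
have -> : transvect (u M) (pos M + w M) v = v.
  apply/funext => n; rewrite /transvect (vM (pos M + w M)%N) ?mulr0l ?addr0//.
  by rewrite posS ltn_add2l wM.
apply: IH => [l lM|n nM]; first by apply: wM; exact: ltnW.
by apply: vM; rewrite (leq_trans nM)// pos_homo.
Qed.

Lemma eq_phi w w' M v : (forall l, (l < M)%N -> w l = w' l) ->
  phi w M v = phi w' M v.
Proof.
elim: M v => //= M IH v ww'; rewrite ww'//; apply: IH => l lM.
by apply: ww'; exact: ltnW.
Qed.

(** The entry of [x - u m] that is read equals [one], so the transvection of index m adds back
    [u m]; those of lower index fix [x] by [phi_block]. *)
Lemma phi_cancel w m (v x : nat -> A) :
  (forall l, (l < m)%N -> (w l < blk l)%N) ->
  (forall n, (n < pos m)%N -> x n = 0) -> v = x - u m ->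
  x (pos m + w m)%N = one -> phi w m.+1 v = x.
Proof.
move=> wm xm -> x1 /=; rewrite -[RHS](phi_block wm xm); congr (phi w m _).
apply/funext => n; rewrite /transvect.
have -> : (x - u m) (pos m + w m)%N = one.
  by rewrite !fctE x1 (u_below (leq_addr _ _)) subr0.
by rewrite mul_one !fctE subrK.
Qed.

End Transvections.

(** * The free action on digit sequences *)

Section Construction.
Variables (R : realType) (A F : finZmodType) (mul : A -> A -> A).
Hypotheses (mulDl : forall x y v, mul (x + y) v = mul x v + mul y v)
  (mul0r : forall x, mul x 0 = 0).
Variables (Delta : zmodType) (c : Delta -> nat -> A).
Hypotheses (cD : forall g h, c (g + h) = c g + c h)
  (c_inj : forall g, (forall n, c g n = 0) -> g = 0)
  (c_fin : forall g, exists M, below M (c g)).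

Lemma level_exists g : exists M, below (pos M) (c g).
Proof.
have [M gM] := c_fin g; exists M => n Mn; apply: gM.
by rewrite (leq_trans _ Mn)// leq_pos.
Qed.

Definition lev g : nat := sval (cid (level_exists g)).

Lemma levP g : below (pos (lev g)) (c g).
Proof. exact: svalP (cid (level_exists g)). Qed.

(** Digit n holds the entries z_n and f_n and the position w_n within block n. *)
Definition digit (n : nat) : finType := (A * F * 'I_(blk n))%type.
Definition digit0 n : digit n := (0, 0, Ordinal (blk_gt0 n)).

Definition omega (x : forall n, digit n) (l : nat) : nat := (x l).2.

Lemma omega_lt x l : (omega x l < blk l)%N.
Proof. exact: ltn_ord. Qed.

Section System.
Variable u : nat -> nat -> A.
Hypothesis u_below : forall m, below (pos m) (u m).

(* The value at [g] of the infinite composition of the transvections: the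
   factors of index at least [lev g] fix [c g]. *)
Definition shear (x : forall n, digit n) (g : Delta) : nat -> A :=
  phi mul u (omega x) (lev g) (c g).

Lemma shearE x g M : below (pos M) (c g) -> shear x g = phi mul u (omega x) M
  (c g).
Proof.
move=> gM; rewrite /shear.
rewrite -(phi_level mulDl u (omega x) (@levP g) (leq_maxl _ M)).
by rewrite -(phi_level mulDl u (omega x) gM (leq_maxr (lev g) _)).
Qed.

Lemma shearD x g h : shear x (g + h) = shear x g + shear x h.
Proof.
pose M := maxn (lev g) (lev h).
have gM : below (pos M) (c g).
  by move=> n Mn; apply: levP; rewrite (leq_trans _ Mn)// pos_homo// leq_maxl.
have hM : below (pos M) (c h).
  by move=> n Mn; apply: levP; rewrite (leq_trans _ Mn)// pos_homo// leq_maxr.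
have ghM : below (pos M) (c (g + h)).
  by move=> n Mn; rewrite cD fctE gM// hM// addr0.
by rewrite (shearE x gM) (shearE x hM) (shearE x ghM) cD phiD.
Qed.

Definition act (g : Delta * F) (x : forall n, digit n) : forall n, digit n :=
  fun n => ((x n).1.1 + shear x g.1 n,
            (x n).1.2 + (if n == 0%N then g.2 else 0), (x n).2).

Lemma shear_act g h x : shear (act g x) h = shear x h.
Proof. exact: eq_phi. Qed.

Lemma act0 : act 0 = id.
Proof.
apply/funext => x; apply: functional_extensionality_dep => n.
have s0 : shear x 0 = 0.
  by apply: (addrI (shear x 0)); rewrite -shearD !addr0.
rewrite /act s0 if_same; case: (x n) => [[z f] w] /=.
by congr (_, _, _); exact: addr0.
Qed.

Lemma actD g h : act (g + h) = act g \o act h.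
Proof.
apply/funext => x; apply: functional_extensionality_dep => n.
have -> : (act g \o act h) x n = ((act h x n).1.1 + shear x g.1 n,
    (act h x n).1.2 + (if n == 0%N then g.2 else 0), (x n).2).
  by rewrite -(shear_act h).
have sE : shear x (g + h).1 n = shear x g.1 n + shear x h.1 n by rewrite shearD.
rewrite /act sE /=; congr (_, _, _);
  first by rewrite (addrC (shear x g.1 n)) addrA.
by case: ifP => _; rewrite ?addr0// (addrC g.2) addrA.
Qed.

(** The successor includes digit 0, on which F acts even when [pos (lev g.1)] is 0. *)
Definition actlev (g : Delta * F) : nat := (pos (lev g.1)).+1.

Lemma act_lev g x n : (actlev g <= n)%N -> act g x n = x n.
Proof.
move=> gn; rewrite /act /shear (phi_below mul0r u_below _ (@levP g.1)) ?(ltnW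
  gn)//.
by rewrite (gtn_eqF (leq_ltn_trans (leq0n _) gn)) !addr0; case: (x n) => [[]].
Qed.

(** [shear] reads the positions w_k for k < [lev g.1] only, and [lev g.1] is at most
    [pos (lev g.1)]. *)
Lemma act_loc g x y : (forall l, (l < actlev g)%N -> x l = y l) ->
  forall l, (l < actlev g)%N -> act g x l = act g y l.
Proof.
move=> xy l lg; rewrite /act xy// /shear (@eq_phi _ _ _ (omega x) (omega y))//.
move=> k kg; rewrite /omega xy// /actlev ltnS ltnW// (leq_trans kg)// leq_pos//.
Qed.

(** A fixed point makes [shear x g] vanish, hence [c g] by [phi_inj]; digit 0 detects the component
    in F. *)
Lemma act_free g : g != 0 -> forall x, act g x <> x.
Proof.
case: g => g f /eqP + x gx; apply.
have gxn n : act (g, f) x n = x n by rewrite gx.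
congr (_, _).
  apply: c_inj; apply: (phi_inj mulDl mul0r u_below (w := omega x) (M := lev
    g)) => n.
  have := congr1 (fun d : digit n => d.1.1) (gxn n).
  by rewrite /= -[RHS]addr0 => /addrI.
have := congr1 (fun d : digit 0 => d.1.2) (gxn 0%N).
by rewrite /= -[RHS]addr0 => /addrI.
Qed.

Definition rotation (g : Delta * F) : R -> R := digact digit0 act actlev g.

Lemma rotation_free : free_system (@leb01 R : probability (lline R) R) rotation.
Proof.
apply: digact_free.
- exact: act0.
- exact: actD.
- exact: act_lev.
- exact: act_loc.
- exact: act_free.
Qed.

Lemma rotation_preserving g (B : set (lline R)) : measurable B ->
  measurable (rotation g @^-1` B : set (lline R)) /\
  leb01 (rotation g @^-1` B) = leb01 B.
Proof.
apply: digact_preserving.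
- exact: act0.
- exact: actD.
- exact: act_lev.
- exact: act_loc.
Qed.

End System.
End Construction.

(** * The sequence, its recurrence and its rigidity *)

Section Sequence.
Variables (R : realType) (A F : finZmodType) (one : A) (mul : A -> A -> A).
Hypotheses (one_neq0 : one != 0)
  (mulDl : forall x y v, mul (x + y) v = mul x v + mul y v)
  (mul_one : forall v, mul one v = v) (mul0r : forall x, mul x 0 = 0).
Variables (Delta : zmodType) (c : Delta -> nat -> A).
Hypotheses (cD : forall g h, c (g + h) = c g + c h)
  (c_inj : forall g, (forall n, c g n = 0) -> g = 0)
  (c_fin : forall g, exists M, below M (c g))
  (c_surj : forall v, (exists M, below M v) -> exists g, c g = v).

Let cB g h : c (g - h) = c g - c h.
Proof. by apply: (addIr (c h)); rewrite -cD !subrK. Qed.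

Let c_injective : injective c.
Proof.
move=> g h gh; apply/eqP; rewrite -subr_eq0; apply/eqP/c_inj => n.
by rewrite cB gh subrr.
Qed.

(** The test excludes n < [pos m], where the truncated difference would be 0; past the end of the
    block [insub] fails. *)
Definition embed_fun m (y : {ffun 'I_(blk m) -> A}) : nat -> A :=
  fun n => if (pos m <= n)%N then oapp y 0 (insub (n - pos m)%N) else 0.

Lemma embed_fun_below m y : exists M, below M (@embed_fun m y).
Proof.
exists (pos m.+1) => n; rewrite posS => mn; rewrite /embed_fun.
by case: ifP => // pn; rewrite insubF// ltn_subLR// ltnNge mn.
Qed.

Definition embed m y : Delta := sval (cid (c_surj (@embed_fun_below m y))).

Lemma embedE m y : c (embed y) = @embed_fun m y.
Proof. exact: (svalP (cid (c_surj _))). Qed.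

Lemma embed_funD m (y z : {ffun 'I_(blk m) -> A}) n :
  embed_fun (y + z) n = embed_fun y n + embed_fun z n.
Proof.
rewrite /embed_fun; case: ifP => _; last by rewrite addr0.
by case: insub => [i|] /=; rewrite ?ffunE ?addr0.
Qed.

Lemma embedB m (y z : {ffun 'I_(blk m) -> A}) : embed (y - z) = embed y - embed
  z.
Proof.
apply: c_injective; rewrite cB !embedE; apply/funext => n.
by apply: (addIr (embed_fun z n)); rewrite -embed_funD !fctE !subrK.
Qed.

Lemma embed_ord m (y : {ffun 'I_(blk m) -> A}) (i : 'I_(blk m)) :
  embed_fun y (pos m + i)%N = y i.
Proof. by rewrite /embed_fun leq_addr addKn valK. Qed.

(* As m runs over nat, [logn 2 m] takes each value infinitely often. *)
Definition shift_fun (m : nat) : nat -> A :=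
  fun n => if (n < pos m)%N then
    nth 0 (odflt [::] (unpickle (logn 2 m) : option (seq A))) n else 0.

Lemma shift_fun_below m : exists M, below M (shift_fun m).
Proof. by exists (pos m) => n mn; rewrite /shift_fun ltnNge mn. Qed.

Definition shift m : Delta := sval (cid (c_surj (shift_fun_below m))).

Lemma shiftE m : c (shift m) = shift_fun m.
Proof. exact: (svalP (cid (c_surj _))). Qed.

Lemma shift_often s K : exists2 m, (K <= m)%N & shift m = s.
Proof.
have [M sM] := c_fin s.
pose k := pickle (mkseq (c s) M).
(* The odd cofactor keeps the 2-adic valuation equal to [k] and makes the index at least [K] and
   [M], so that the cut at [pos m] loses no entry of [s]. *)
exists (2 ^ k * (2 * (K + M)).+1)%N.
  by rewrite (@leq_trans (2 * (K + M)).+1)// ?leq_pmull ?expn_gt0//; lia.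
apply: c_injective; rewrite shiftE; apply/funext => n; rewrite /shift_fun.
have -> : logn 2 (2 ^ k * (2 * (K + M)).+1) = k.
  by rewrite lognM ?expn_gt0// lognX logn_prime// muln1 lognE/= dvdn2 /= mul2n
    odd_double addn0.
rewrite pickleK /=; case: ifP => nm.
  have [nM|nM] := ltnP n M; first by rewrite nth_mkseq.
  by rewrite nth_default ?size_mkseq// sM.
apply/esym/sM; rewrite leqNgt; apply/negP => nM; move/negP: nm; apply.
rewrite (leq_trans nM)// (leq_trans _ (leq_pos _))//.
by rewrite (@leq_trans (2 * (K + M)).+1)// ?leq_pmull ?expn_gt0//; lia.
Qed.

Definition block (m : nat) : seq (Delta * F) :=
  [seq (shift m + embed y, 0) | y <- enum {ffun 'I_(blk m) -> A}
     & (m.+1 * defects one y <= blk m)%N].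

Lemma blockP m g : g \in block m -> exists2 y : {ffun 'I_(blk m) -> A},
  (m.+1 * defects one y <= blk m)%N & g = (shift m + embed y, 0).
Proof. by move=> /mapP[y]; rewrite mem_filter => /andP[ym _] ->; exists y. Qed.

Lemma mem_block m (y : {ffun 'I_(blk m) -> A}) :
  (m.+1 * defects one y <= blk m)%N -> (shift m + embed y, 0) \in block m.
Proof. by move=> ym; apply: map_f; rewrite mem_filter ym mem_enum. Qed.

Lemma block_recurrence (r : nat -> Delta * F) (s : Delta) :
  (forall m g, g \in block m -> exists n, r n = g) ->
  set_of_recurrence R (range (fun n => r n - (s, 0))).
Proof.
move=> hr; apply: set_of_recurrenceP => w0.
(* As [shift m = s], subtracting [s] from block m leaves the embedded vectors with few defects; the
   bound also gives m > 0. *)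
have [m mw tm] := shift_often s w0.+1.
exists m.+1; first by rewrite (leq_trans _ (leqnSn m))// ltnW.
exists {ffun 'I_(blk m) -> A}, (fun y => (embed y, 0)); split.
  by apply/card_gt0P; exists 0.
move=> B /(dense_difference one (ltn0Sn m))[b [b' [bB b'B bb']]].
exists b, b'; split => //.
  have [n rn] := hr _ _ (mem_block bb'); exists n => //; rewrite rn tm.
  by congr (_, _); rewrite ?subr0// embedB addrAC subrr add0r.
(* The zero vector has [blk m] defects, which exceeds [blk m] / (m+1) because m > 0. *)
apply/eqP => -[] /eqP; rewrite -embedB => /eqP e0.
have z i : (b' - b) i = 0 by rewrite -embed_ord -embedE e0 -(subrr 0) cB subrr.
move: bb'; rewrite /defects (eq_bigr (fun=> 1%N)); last first.
  by move=> i _; rewrite z eq_sym one_neq0.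
rewrite sum1_card card_ord -/(blk m) -[leqRHS]mul1n leq_pmul2r ?blk_gt0//.
by rewrite ltnS leqn0 => /eqP m0; rewrite m0 in mw.
Qed.

(** [A] has the two elements 0 and [one], so each digit at least doubles the radix. *)
Lemma radix_gt m : (m < radix (digit A F) m)%N.
Proof.
elim: m => [|m IH]; first by rewrite radix_gt0//; exact: digit0.
rewrite radixS (@leq_trans (radix (digit A F) m * 2))//; first by lia.
rewrite leq_mul2l; apply/orP; right.
rewrite /digit !card_prod card_ord (@leq_trans #|A|)//.
  by rewrite (cardD1 0) (cardD1 one) !inE one_neq0.
by rewrite -mulnA leq_pmulr// muln_gt0 blk_gt0 andbT; apply/card_gt0P; exists 0.
Qed.

Lemma block_rigidity (r : nat -> Delta * F) (s : Delta) :
  (forall M, exists n0, forall n, (n0 <= n)%N ->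
     exists2 m, (M <= m)%N & r n \in block m) ->
  exists (d : measure_display) (X : measurableType d) (mu : probability X R)
     (T : Delta * F -> X -> X), free_system mu T /\
     rigidity_sequence mu T (fun n => r n - (s, 0)).
Proof.
move=> hr.
(* The cut makes [u_below] hold for every m; once [pos m] bounds the support of [s], this is
   [c s - c (shift m)] itself. *)
pose u m n := if (n < pos m)%N then c s n - c (shift m) n else 0.
have u_below m : below (pos m) (u m) by move=> n mn; rewrite /u ltnNge mn.
pose T : Delta * F -> R -> R := rotation mul c_fin u.
exists _, (lline R), (@leb01 R : probability (lline R) R), T.
split; first exact: rotation_free.
move=> f f2; apply: rigid_leb01_L2 => //.
  by move=> n B; exact: rotation_preserving.
move=> e e' e0 e'0.
have [M sM] := c_fin s.
pose K := maxn M (maxn (Num.truncn e^-1) (Num.truncn e'^-1)).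
have [n0 hn0] := hr K; exists n0 => n /hn0[m Km /blockP[y ym rn]].
have [Mm em e'm] : [/\ (M <= m)%N, (Num.truncn e^-1 <= m)%N & (Num.truncn e'^-1
  <= m)%N].
  by move: Km; rewrite !geq_max => /and3P[].
(* The bad event that [y] differs from [one] at the random position w_m; its probability is at most
   1/(m+1). *)
pose Q : {set digit A F m} := [set d | y d.2 != one]%SET.
have cQ : #|Q| = (#|A| * #|F| * defects one y)%N.
  have -> : Q = finset.setX [set: A * F]%SET [set i | y i != one]%SET.
    by apply/setP => -[af i]; rewrite !inE.
  rewrite cardsX cardsT card_prod; congr muln.
  rewrite -sum1_card big_mkcond /defects; apply: eq_bigr => i _.
  by rewrite inE; case: (_ != _).
have [mQ muQ] := leb01_dig R (@digit0 A F) Q.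
exists [set x | 0 <= x < 1 /\ dig (@digit0 A F) x m \in Q]; split => //.
- rewrite muQ lee_fin cQ /digit !card_prod card_ord.
  have k0 : 0 < (blk m)%:R :> R by rewrite ltr0n blk_gt0.
  have af0 : (#|A| * #|F|)%:R != 0 :> R.
    rewrite pnatr_eq0 -lt0n muln_gt0.
    by apply/andP; split; apply/card_gt0P; exists 0.
  rewrite natrM [X in _ / X]natrM -mulf_div divff// mul1r ler_pdivrMr//.
  have e'1 : 1 <= e' * m.+1%:R.
    rewrite -ler_pdivrMl// mulr1 ltW// (lt_le_trans (truncnS_gt _))//.
    by rewrite ler_nat.
  apply: (@le_trans _ _ (e' * (m.+1 * defects one y)%:R)); last first.
    by rewrite ler_pM2l// ler_nat.
  by rewrite natrM mulrA ler_peMl.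
- move=> x x01 nQ; rewrite rn.
  have y1 : y (dig (@digit0 A F) x m).2 = one.
    by apply/eqP/negPn/negP => yx; apply: nQ; split => //; rewrite inE.
  apply: (@le_trans _ _ (radix (digit A F) (pos m))%:R^-1); last first.
    rewrite -[leRHS]invrK lef_pV2 ?posrE ?ltr0n ?radix_gt0 ?invr_gt0//;
      last exact: digit0.
    rewrite ltW// (lt_le_trans (truncnS_gt _))// ler_nat.
    by rewrite (leq_ltn_trans em)// (leq_ltn_trans (leq_pos _) (radix_gt _)).
  apply: digact_close => //; first by move=> *; exact: act_lev.
  set g1 := shift m + embed y - s.
  (* The form required by [phi_cancel], with the embedded [y] in the role of [x]. *)
  have g1E : c g1 = embed_fun y - u m.
    rewrite /g1 cB cD shiftE embedE; apply/funext => k; rewrite !fctE /u shiftE.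
    case: ifP => km; first by rewrite opprB [RHS]addrCA addrA.
    rewrite subr0 sM ?subr0; last first.
      by rewrite (leq_trans Mm)// (leq_trans (leq_pos m))// leqNgt km.
    by rewrite /shift_fun km add0r.
  have y_below k : (k < pos m)%N -> embed_fun y k = 0.
    by move=> km; rewrite /embed_fun leqNgt km.
  have g1_below : below (pos m.+1) (c g1).
    move=> k mk; have km : (pos m <= k)%N by rewrite (leq_trans _ mk)//
      pos_homo.
    rewrite g1E !fctE u_below// subr0 /embed_fun km insubF//.
    by rewrite ltn_subLR// ltnNge -posS mk.
  (* Off the bad event the shear of [g1] is the embedded [y], which vanishes before block m; the
     component in F is 0. *)
  move=> l lm; rewrite /act /= subrr if_same addr0.
  rewrite (shearE mulDl c_fin u _ g1_below).
  rewrite (phi_cancel mulDl mul_one u_below _ y_below g1E).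
  - by rewrite y_below// addr0; case: (dig _ x l) => [[]].
  - by move=> k _; exact: omega_lt.
  - by rewrite embed_ord.
Qed.

Lemma translates_freely_rigid_recurrent : exists r : nat -> Delta * F,
  forall s, freely_rigid_recurrent R (fun n => r n - (s, 0)).
Proof.
(* The constant vector [one] has no defects, so every block is nonempty. *)
have hdL m : (shift m + embed ([ffun=> one] : {ffun 'I_(blk m) -> A}), 0) \in
  block m.
  apply: mem_block; rewrite /defects big1 ?muln0// => i _.
  by rewrite ffunE eqxx.
have [r [r_onto r_late]] := enum_blocks hdL.
exists r => s; split; first exact: block_rigidity.
exact: block_recurrence.
Qed.

End Sequence.

(** * Finitely supported families of residues *)

Section Residues.
Variables (N : nat) (p : 'I_N -> nat).

(* An alias of the type of dependent finite functions, which carries no group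
   structure in the library. *)
Definition residues := {dffun forall j : 'I_N, 'Z_(p j)}.

HB.instance Definition _ := Finite.on residues.

Implicit Types x y z : residues.

Definition res0 : residues := [ffun=> 0].
Definition res_opp x : residues := [ffun j => - x j].
Definition res_add x y : residues := [ffun j => x j + y j].
Definition res_mul x y : residues := [ffun j => x j * y j].
Definition res1 : residues := [ffun=> 1].

Lemma res_addA : associative res_add.
Proof. by move=> x y z; apply/ffunP => j; rewrite !ffunE addrA. Qed.

Lemma res_addC : commutative res_add.
Proof. by move=> x y; apply/ffunP => j; rewrite !ffunE addrC. Qed.

Lemma res_add0 : left_id res0 res_add.
Proof. by move=> x; apply/ffunP => j; rewrite !ffunE add0r. Qed.

Lemma res_addN : left_inverse res0 res_opp res_add.
Proof. by move=> x; apply/ffunP => j; rewrite !ffunE addNr. Qed.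

HB.instance Definition _ := GRing.isZmodule.Build residues
  res_addA res_addC res_add0 res_addN.

Lemma res_mulDl x y z : res_mul (x + y) z = res_mul x z + res_mul y z.
Proof. by apply/ffunP => j; rewrite !ffunE mulrDl. Qed.

Lemma res_mul1 x : res_mul res1 x = x.
Proof. by apply/ffunP => j; rewrite !ffunE mul1r. Qed.

Lemma res_mul0r x : res_mul x 0 = 0.
Proof. by apply/ffunP => j; rewrite !ffunE mulr0. Qed.

Lemma res1_neq0 : (0 < N)%N -> res1 != 0.
Proof.
move=> N0; apply/eqP => /ffunP/(_ (Ordinal N0)).
by rewrite !ffunE => /eqP; rewrite oner_eq0.
Qed.

(** Exchanging the two indices turns Delta into the group of finitely supported functions from [nat]
    to [residues]. *)
Definition coords (g : torsion_sum p) (n : nat) : residues := [ffun j => g j n].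

Lemma coordsD g h : coords (g + h) = coords g + coords h.
Proof. by apply/funext => n; apply/ffunP => j; rewrite !ffunE. Qed.

Lemma coords_inj g : (forall n, coords g n = 0) -> g = 0.
Proof.
move=> g0; apply: dirsumP => j; apply: dirsumP => n.
by have /ffunP/(_ j) := g0 n; rewrite !ffunE.
Qed.

Lemma coords_fin g : exists M, below M (coords g).
Proof.
have bound j : exists M, forall n, (M <= n)%N -> g j n = 0.
  have /finite_seqP[s sE] := dirsum_finite (g j).
  exists (\max_(i <- s) i).+1 => n; apply: contraPeq => /eqP gn.
  have : [set` s] n by rewrite -sE.
  by move=> /= ns; rewrite ltnNge leq_bigmax_seq.
exists (\max_j sval (cid (bound j))) => n Mn; apply/ffunP => j.
rewrite !ffunE; apply: (svalP (cid (bound j))).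
exact: leq_trans (leq_bigmax j) Mn.
Qed.

Lemma coords_surj v : (exists M, below M v) -> exists g, coords g = v.
Proof.
move=> [M vM].
have fin1 j : finite_set [set n | v n j <> 0].
  apply: (@sub_finite_set _ _ `I_M) => // n /= vn.
  by rewrite ltnNge; apply/negP => /vM v0; apply: vn; rewrite v0 ffunE.
pose g1 j := DirSum (fin1 j) : dirsum (fun _ : nat => 'Z_(p j) : zmodType).
have fin2 : finite_set [set j | g1 j <> 0] by exact: finite_finset.
exists (DirSum fin2); apply/funext => n; apply/ffunP => j.
by rewrite ffunE.
Qed.

End Residues.

Theorem theorem1p5 (R : realType) (N : nat) (hN : (1 <= N)%N)
    (p : 'I_N -> nat) (hp : forall j, prime (p j)) (F : finZmodType) :
  exists r : nat -> (torsion_sum p * F)%type,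
    forall s : torsion_sum p,
      freely_rigid_recurrent R (fun n => r n - (s, 0)).
Proof.
exact: (translates_freely_rigid_recurrent R F (res1_neq0 p hN) (@res_mulDl _ p)
  (@res_mul1 _ p) (@res_mul0r _ p) (@coordsD _ p) (@coords_inj _ p)
  (@coords_fin _ p) (@coords_surj _ p)).
Qed.
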